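(* There is a polynomial representation $\pi$ of the algebra $\mathcal A^*$ with $\pi(\mathcal Q^*_{\alpha,n})=\mathcal D_{\alpha,n}$. That is, acting by left multiplication on polynomials in $\mathbf z$, the operators $\mathcal D_{\alpha,n}$ obey the dual quantum $Q$-system relations for $A_r$: for all $\alpha,\beta\in[1,r]$ and $n,p\in\mathbb Z$, $$\mathcal D_{\alpha,n}\,\mathcal D_{\beta,p}=v^{-\Lambda_{\alpha,\beta}(p-n)}\,\mathcal D_{\beta,p}\,\mathcal D_{\alpha,n}\qquad\text{whenever }|p-n|\leq|\beta-\alpha|+1,$$ $$v^{-\Lambda_{\alpha,\alpha}}\,\mathcal D_{\alpha,n+1}\,\mathcal D_{\alpha,n-1}=(\mathcal D_{\alpha,n})^2-v^{-r-1}\,\mathcal D_{\alpha+1,n}\,\mathcal D_{\alpha-1,n}.$$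
   Context: Fix $r\ge1$; $v$ is an indeterminate (with a chosen square root $v^{1/2}$), $q=v^{-r-1}$, $\mathbf z=(z_1,\dots,z_{r+1})$ with $z_1z_2\cdots z_{r+1}=1$. Put $\Lambda_{\alpha,\beta}=\min(\alpha,\beta)(r+1-\max(\alpha,\beta))$, which vanishes if $\alpha$ or $\beta$ is $0$ or $r+1$. The algebra $\mathcal A^*$ is generated over $\mathbb Z[v,v^{-1}]$ by $\mathcal Q^*_{\alpha,k}$ ($\alpha\in[1,r]$, $k\in\mathbb Z$), with $\mathcal Q^*_{0,k}=\mathcal Q^*_{r+1,k}=1$, modulo the relations $\mathcal Q^*_{\alpha,n}\mathcal Q^*_{\beta,p}=v^{-\Lambda_{\alpha,\beta}(p-n)}\mathcal Q^*_{\beta,p}\mathcal Q^*_{\alpha,n}$ for $|p-n|\le|\beta-\alpha|+1$, and $v^{\Lambda_{\alpha,\alpha}}\mathcal Q^*_{\alpha,n-1}\mathcal Q^*_{\alpha,n+1}=(\mathcal Q^*_{\alpha,n})^2-\mathcal Q^*_{\alpha+1,n}\mathcal Q^*_{\alpha-1,n}$; the second relation is rewritten equivalently as $v^{-\Lambda_{\alpha,\alpha}}\mathcal Q^*_{\alpha,n+1}\mathcal Q^*_{\alpha,n-1}=(\mathcal Q^*_{\alpha,n})^2-v^{-r-1}\mathcal Q^*_{\alpha+1,n}\mathcal Q^*_{\alpha-1,n}$. For $i\in[1,r+1]$, $(D_if)(\mathbf z)=f(vz_1,\dots,vz_{i-1},qvz_i,vz_{i+1},\dots,vz_{r+1})$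 (this preserves $z_1\cdots z_{r+1}=1$). For $I\subset[1,r+1]$ with complement $\bar I$: $z_I=\prod_{i\in I}z_i$, $D_I=\prod_{i\in I}D_i$, $a_I(\mathbf z)=\prod_{i\in I,\,j\in\bar I}\frac{z_i}{z_i-z_j}$. For $\alpha\in[0,r+1]$, $n\in\mathbb Z$, $$\mathcal D_{\alpha,n}=v^{-\frac{\Lambda_{\alpha,\alpha}}{2}n-\sum_{\beta=1}^r\Lambda_{\alpha,\beta}}\sum_{I\subset[1,r+1],\,|I|=\alpha}(z_I)^n\,a_I(\mathbf z)\,D_I ,$$ so $\mathcal D_{0,n}=\mathcal D_{r+1,n}=1$. These are difference operators with rational coefficients in $\mathbf z$, and products are compositions of operators. *)

(* Defs.v *)
From HB Require Import structures.
From mathcomp Require Import all_boot all_order all_algebra generic_quotient.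
From mathcomp Require Import ring_quotient fraction boolp.
From mathcomp Require Import mpoly.
From mathcomp Require monalg.

Set Implicit Arguments.
Unset Strict Implicit.
Unset Printing Implicit Defensive.

Import GRing.Theory.
Local Open Scope ring_scope.

Notation "x %:F" := (tofrac x) : ring_scope.

Definition Lam (r a b : nat) : nat := (minn a b * (r.+1 - maxn a b))%N.

(* Rational functions in z_1, ..., z_{r+1} subject to z_1 ... z_{r+1} = 1 are
   the rational functions in the free variables z_1, ..., z_r. *)
Notation ratfun K r := {fraction {mpoly K[r]}}.

Section DifferenceOperators.

(* vh is the chosen square root of v. *)
Variables (K : fieldType) (vh : K) (r : nat).

Let v : K := vh ^+ 2.
Let q : K := v ^- r.+1.

Definition cst (c : K) : ratfun K r := (c%:MP)%:F.

Definition z (i : 'I_r.+1) : ratfun K r :=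
  if unlift ord_max i is Some j then ('X_j)%:F
  else (\prod_(j < r) ('X_j)%:F)^-1.

(* f(x_1, ..., x_{r+1}) for a point x with x_1 ... x_{r+1} = 1; it is only
   meaningful when the denominator of f does not vanish at x, as is the case at
   the points x_j = c_j z_j with c_j != 0 used below. *)
Definition ev (x : 'I_r.+1 -> ratfun K r) (f : ratfun K r) : ratfun K r :=
  let x' j := x (lift ord_max j) in
  mmap cst x' \n_(repr f) / mmap cst x' \d_(repr f).

Definition shift (i : 'I_r.+1) (f : ratfun K r) : ratfun K r :=
  ev (fun j => cst (if j == i then q * v else v) * z j) f.

Definition shiftI (I : {set 'I_r.+1}) : ratfun K r -> ratfun K r :=
  \big[comp/id]_(i in I) shift i.

Definition zI (I : {set 'I_r.+1}) : ratfun K r := \prod_(i in I) z i.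

Definition aI (I : {set 'I_r.+1}) : ratfun K r :=
  \prod_(i in I) \prod_(j in ~: I) (z i / (z i - z j)).

(* The power v^(-x) of the prefactor is written vh^(-2x). *)
Definition Dop (a : nat) (n : int) (f : ratfun K r) : ratfun K r :=
  cst (vh ^ (- ((Lam r a a)%:Z * n)
             - ((\sum_(1 <= b < r.+1) Lam r a b).*2)%N%:Z))
  * \sum_(I : {set 'I_r.+1} | #|I| == a) zI I ^ n * aI I * shiftI I f.

(* Symmetric polynomials in z_1, ..., z_{r+1} on z_1 ... z_{r+1} = 1. *)
Definition sympoly (f : ratfun K r) : Prop :=
  exists2 p : {mpoly K[r.+1]}, p \is symmetric & f = mmap cst z p.

End DifferenceOperators.

(* The field Q(v^{1/2}). *)
Notation Kv := {fraction {poly rat}}.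
Definition vh : Kv := 'X%:F.
Definition v : Kv := vh ^+ 2.

(* Z[v, v^-1], as a subring of Q(v^{1/2}). *)
Definition laurent : {pred Kv} := fun x =>
  `[< exists (p : {poly int}) (n : nat), x = (map_poly intr p).[v] / v ^+ n >].

Lemma v_neq0 : v != 0.
Proof. by rewrite expf_neq0 // /vh tofrac_eq0 polyX_eq0. Qed.

Fact laurent_subring : subring_closed laurent.
Proof.
split=> [|x y /asboolP[p [n ->]] /asboolP[s [m ->]]
         |x y /asboolP[p [n ->]] /asboolP[s [m ->]]]; apply/asboolP.
- by exists 1, 0; rewrite rmorph1 hornerC expr0 divr1.
- exists (p * 'X^m - s * 'X^n), (n + m)%N.
  rewrite rmorphB !rmorphM /= !map_polyXn hornerD hornerN !hornerM !hornerXn.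
  rewrite exprD -[X in X - _](mulfK (expf_neq0 m v_neq0)).
  rewrite -[X in _ - X](mulfK (expf_neq0 n v_neq0)) mulrBl !invfM.
  congr (_ - _); rewrite -!mulrA; congr (_ * _).
    by rewrite mulrCA.
  by rewrite mulrCA; congr (_ * _); rewrite mulrC.
- exists (p * s), (n + m)%N; rewrite rmorphM hornerM exprD invfM.
  by rewrite mulrACA.
Qed.
HB.instance Definition _ := GRing.isSubringClosed.Build Kv laurent
  laurent_subring.

Record Zv := MkZv { Zv_val :> Kv; _ : Zv_val \in laurent }.
HB.instance Definition _ := [isSub for Zv_val].
HB.instance Definition _ := [Choice of Zv by <:].
HB.instance Definition _ := [SubChoice_isSubComNzRing of Zv by <:].

Fact vexp_laurent (k : int) : v ^ k \in laurent.
Proof.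
apply/asboolP; case: k => n.
  by exists 'X^n, 0; rewrite map_polyXn hornerXn expr0 divr1.
by exists 1, n.+1; rewrite rmorph1 hornerC div1r.
Qed.

Definition vexp (k : int) : Zv := MkZv (vexp_laurent k).


(* The quotient of an algebra B by the two-sided ideal generated by the
   elements satisfying relator. *)
Section Presentation.

Variables (R : comNzRingType) (B : lalgType R) (relator : B -> Prop).

Inductive in_ideal : B -> Prop :=
| Ideal_relator x : relator x -> in_ideal x
| Ideal0 : in_ideal 0
| IdealB x y : in_ideal x -> in_ideal y -> in_ideal (x - y)
| IdealMl b x : in_ideal x -> in_ideal (b * x)
| IdealMr b x : in_ideal x -> in_ideal (x * b).

Definition idealp : {pred B} := fun x => `[< in_ideal x >].

Fact idealp_zmod : zmod_closed idealp.
Proof.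
split=> [|x y /asboolP Ix /asboolP Iy]; apply/asboolP; first exact: Ideal0.
exact: IdealB.
Qed.
HB.instance Definition _ := GRing.isZmodClosed.Build B idealp idealp_zmod.

Fact idealpMl b x : x \in idealp -> b * x \in idealp.
Proof. by move/asboolP=> Ix; apply/asboolP/IdealMl. Qed.

Fact idealpMr b x : x \in idealp -> x * b \in idealp.
Proof. by move/asboolP=> Ix; apply/asboolP/IdealMr. Qed.

Definition presented := Quotient.quot idealp.
HB.instance Definition _ := GRing.Zmodule.on presented.

Definition pclass (x : B) : presented := \pi_presented%qT x.

Fact pclassP x y : reflect (pclass x = pclass y) (x - y \in idealp).
Proof. by rewrite Quotient.idealrBE; exact: eqP. Qed.

Definition pone : presented := pclass 1.
Definition pmul (x y : presented) : presented := pclass (repr x * repr y).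
Definition pscale (c : R) (x : presented) : presented := pclass (c *: repr x).

Fact pclassK (x : presented) : pclass (repr x) = x.
Proof. exact: reprK. Qed.

Fact pclassB x y : pclass (x - y) = pclass x - pclass y.
Proof. exact: raddfB. Qed.

Fact pclassD x y : pclass (x + y) = pclass x + pclass y.
Proof. exact: raddfD. Qed.

Fact pclassKB x : x - repr (pclass x) \in idealp.
Proof. by apply/pclassP; rewrite pclassK. Qed.

Fact pclassM x y : pclass (x * y) = pmul (pclass x) (pclass y).
Proof.
apply/pclassP; rewrite -(subrKA (x * repr (pclass y))) -mulrBr -mulrBl.
by apply: rpredD; [apply: idealpMl|apply: idealpMr]; exact: pclassKB.
Qed.

Fact pclassZ c x : pclass (c *: x) = pscale c (pclass x).
Proof.
apply/pclassP; rewrite -scalerBr -[X in c *: X]mul1r scalerAl.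
by apply: idealpMl; exact: pclassKB.
Qed.

Fact pmulA : associative pmul.
Proof.
by move=> x y t; rewrite -[x]pclassK -[y]pclassK -[t]pclassK -!pclassM mulrA.
Qed.

Fact pmul1l : left_id pone pmul.
Proof. by move=> x; rewrite -[x]pclassK -pclassM mul1r. Qed.

Fact pmul1r : right_id pone pmul.
Proof. by move=> x; rewrite -[x]pclassK -pclassM mulr1. Qed.

Fact pmulDl : left_distributive pmul +%R.
Proof.
move=> x y t; rewrite -[x]pclassK -[y]pclassK -[t]pclassK.
by rewrite -pclassD -!pclassM mulrDl pclassD.
Qed.

Fact pmulDr : right_distributive pmul +%R.
Proof.
move=> x y t; rewrite -[x]pclassK -[y]pclassK -[t]pclassK.
by rewrite -pclassD -!pclassM mulrDr pclassD.
Qed.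

HB.instance Definition _ := GRing.Zmodule_isPzRing.Build presented
  pmulA pmul1l pmul1r pmulDl pmulDr.

Fact pscaleA c d x : pscale c (pscale d x) = pscale (c * d) x.
Proof. by rewrite -[x]pclassK -!pclassZ scalerA. Qed.

Fact pscale1 : left_id 1 pscale.
Proof. by move=> x; rewrite -[x]pclassK -pclassZ scale1r. Qed.

Fact pscaleDr : right_distributive pscale +%R.
Proof.
move=> c x y; rewrite -[x]pclassK -[y]pclassK.
by rewrite -pclassD -!pclassZ scalerDr pclassD.
Qed.

Fact pscaleDl x : {morph pscale^~ x : c d / c + d}.
Proof.
by move=> c d; rewrite -[x]pclassK -!pclassZ scalerDl pclassD.
Qed.

HB.instance Definition _ := GRing.Zmodule_isLmodule.Build R presented
  pscaleA pscale1 pscaleDr pscaleDl.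

Fact pclass_mul x y : pclass (x * y) = pclass x * pclass y.
Proof. exact: pclassM. Qed.

Fact pclass_scale c x : pclass (c *: x) = c *: pclass x.
Proof. exact: pclassZ. Qed.

Fact pscaleAl c (x y : presented) : c *: (x * y) = (c *: x) * y.
Proof.
rewrite -[x]pclassK -[y]pclassK.
by rewrite -pclass_mul -!pclass_scale -pclass_mul scalerAl.
Qed.

End Presentation.

Section DualQSystemAlgebra.

Import monalg.

Variable r : nat.

Definition freeA := {malg Zv[{fmonom ('I_r.+2 * int)%type}]}.

(* Only used for a <= r + 1. *)
Definition freeQ (a : nat) (k : int) : freeA := << fmu (inord a, k) >>.

Inductive relatorA : freeA -> Prop :=
| Rel_zero k : relatorA (freeQ 0 k - 1)
| Rel_last k : relatorA (freeQ r.+1 k - 1)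
| Rel_comm (a b : nat) (n p : int) :
    (1 <= a <= r)%N -> (1 <= b <= r)%N -> `|p - n| <= `|b%:Z - a%:Z| + 1 ->
    relatorA (freeQ a n * freeQ b p
              - vexp (- ((Lam r a b)%:Z * (p - n))) *: (freeQ b p * freeQ a n))
| Rel_Qsys (a : nat) (n : int) :
    (1 <= a <= r)%N ->
    relatorA (vexp (Lam r a a)%:Z *: (freeQ a (n - 1) * freeQ a (n + 1))
              - (freeQ a n ^+ 2 - freeQ a.+1 n * freeQ a.-1 n)).

Definition algA := presented relatorA.
HB.instance Definition _ := GRing.PzRing.on algA.
HB.instance Definition _ := GRing.Lmodule.on algA.

Definition genQ (a : nat) (k : int) : algA := pclass relatorA (freeQ a k).

End DualQSystemAlgebra.

(* A representation of algA, by linear operators on rational functions.  The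
   difference operators do not preserve all polynomials; the subspace sympoly
   of symmetric ones is the one that is stable. *)
Record representation (r : nat) (rho : algA r -> ratfun Kv r -> ratfun Kv r)
  : Prop := Representation {
  repr_addr x f g : rho x (f + g) = rho x f + rho x g;
  repr_cst x c f : rho x (cst r c * f) = cst r c * rho x f;
  repr_add x y f : rho (x + y) f = rho x f + rho y f;
  repr_scale (c : Zv) x f : rho (c *: x) f = cst r (c : Kv) * rho x f;
  repr_one f : rho 1 f = f;
  repr_mul x y f : rho (x * y) f = rho x (rho y f)
}.

(* Main.v *)
From HB Require Import structures.
Require Import Defs.
From mathcomp Require Import all_boot all_order all_fingroup all_algebra.
From mathcomp Require Import generic_quotient fraction boolp mpoly.
From mathcomp Require monalg.
From mathcomp Require Import ring zify.

Set Implicit Arguments.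
Unset Strict Implicit.
Unset Printing Implicit Defensive.

Import GRing.Theory.
Local Open Scope ring_scope.

(** Write N = r + 1.  The product of D_(a,n) and D_(b,p) is a sum over pairs
    (I, J) of subsets, and the composite shift D_I D_J depends only on the
    intersection C of I and J and on their symmetric difference S.  Write
    I = C + A and J = C + B, where A + B = S is a splitting of S.  The factors
    of a_I and of the shifted a_J that involve a point outside S combine into a
    product kappa C S that does not see the splitting (aI_pair).  What remains
    (Dop_comp) is, for each (C, S), a multiple of

      sum over A + B = S, |A| = a', of z_A^k z_B^l
        prod_(i in A, j in B) 1 / ((z_i - z_j) (z_j - q z_i)),

    called splitsum a' k l S, so each relation between the operators is a
    linear relation between such sums (splitsum_comm, splitsum_qsys,
    splitsum_qsys_dual).

    These relations hold by induction on S.  Powers of the product over S factor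
    out, so k and l may be taken nonnegative.  As a function of one z_i, with the
    other points fixed, such a sum then has simple poles only, all outside 0.
    Those at z_i = z_j cancel in pairs, because exchanging i and j permutes the
    terms.  The residue at z_i = q z_j or z_j = q z_i is a common factor times the sum of the same
    shape over S minus i and j, so a combination whose residues vanish by
    induction is a polynomial in z_i; it tends to 0 at infinity, hence it is 0.
    This is lincomb_vanish, where the argument is carried out by clearing
    denominators and counting the roots of a polynomial in one variable, at
    points of an arbitrary field subject to a genericity condition.  The z_i
    satisfy that condition: a relation z_i = q^k z_j with i != j would be broken
    by the i-th shift, which scales z_i and z_j differently (z_generic).

    For a symmetric polynomial f, lift the sum defining D_(a,n) f to independent
    variables X_i.  Multiplied by the product disc of the differences X_i - X_j
    over ordered pairs, it is a symmetric polynomial that vanishes for X_i = X_j.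
    A symmetric polynomial vanishing there vanishes twice, so it is a multiple of
    disc, and D_(a,n) f is a symmetric polynomial (sympoly_Dop).

    Finally the free algebra acts by words in the operators, and the relators
    act by 0.  The relator of the exchange relation has the factors of indices
    n - 1 and n + 1 in the opposite order from the exchange relation asserted for
    the operators; both orders are instances of the same termwise argument
    (Dop_qsys_termwise). *)

(** * Sums over the two-block decompositions of a finite set of points *)

Section SplitSums.

Variables (F : fieldType) (q : F) (T : finType) (x : T -> F).

Definition setpow (e : int) (A : {set T}) : F := \prod_(s in A) x s ^ e.

(** The weight of a pair separated by a splitting, the first point lying in the
    part that comes from I. *)
Definition pairw (u w : F) : F := ((u - w) * (w - q * u))^-1.

Definition pairwS (A B : {set T}) : F :=
  \prod_(s in A) \prod_(t in B) pairw (x s) (x t).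

Definition splitterm (k l : int) (A B : {set T}) : F :=
  setpow k A * setpow l B * pairwS A B.

Definition splitsum (a : nat) (k l : int) (S : {set T}) : F :=
  \sum_(A : {set T} | (A \subset S) && (#|A| == a)) splitterm k l A (S :\: A).

Lemma sum_subsets_setD1 (i : T) (S : {set T}) (f : {set T} -> F) : i \in S ->
  \sum_(A : {set T} | A \subset S) f A
  = \sum_(A : {set T} | A \subset S :\ i) (f (i |: A) + f A).
Proof.
move=> iS; rewrite big_split /= (bigID (fun A : {set T} => i \in A)) /=.
congr (_ + _); last by apply: eq_bigl => A; rewrite subsetD1.
rewrite (reindex_onto (fun A : {set T} => i |: A) (fun A => A :\ i)) /=; last first.
  by move=> A /andP[_ iA]; rewrite setD1K.
apply: eq_bigl => A; rewrite setU11 andbT subUset sub1set iS subsetD1 /=.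
congr (_ && _); apply/eqP/idP => [<-|iA]; first by rewrite !inE eqxx.
by rewrite setU1K.
Qed.

Lemma splitterm_addl i k l (A B : {set T}) : i \notin A ->
  splitterm k l (i |: A) B
  = x i ^ k * (\prod_(t in B) pairw (x i) (x t)) * splitterm k l A B.
Proof.
by move=> iA; rewrite /splitterm /setpow /pairwS !big_setU1 //=; ring.
Qed.

Lemma splitterm_addr j k l (A B : {set T}) : j \notin B ->
  splitterm k l A (j |: B)
  = x j ^ l * (\prod_(s in A) pairw (x s) (x j)) * splitterm k l A B.
Proof.
move=> jB; rewrite /splitterm /setpow /pairwS big_setU1 //=.
under [\prod_(s in A) \prod_(t in _) _]eq_bigr do rewrite big_setU1 //=.
by rewrite big_split /=; ring.
Qed.

(** The three roots are the values of 'X at which a term has a pole coming from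
    the point x s. *)
Definition polefactor (s : T) : {poly F} :=
  ('X - (x s)%:P) * ((x s)%:P - q *: 'X) * ('X - (q * x s)%:P).

Definition polefactor_at (y : F) (s : T) : F :=
  (y - x s) * (x s - q * y) * (y - q * x s).

(** Replace the value at a distinguished point i by 'X in the sum over splittings
    of i |: D, and multiply by the product of the pole factors of D.  The first
    kind of term has i in A, the second has i in B; in each of them the weights
    of i against the opposite part cancel two of the three linear factors. *)
Definition cleared (a k l : nat) (D : {set T}) : {poly F} :=
  \sum_(A : {set T} | A \subset D)
    ((if #|A|.+1 == a then
        splitterm k l A (D :\: A) *: ('X^k *
          \prod_(s in D) if s \in A then polefactor s else 'X - (q * x s)%:P)
      else 0) +
     (if #|A| == a then
        splitterm k l A (D :\: A) *: ('X^l *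
          \prod_(s in D) if s \in A then q *: 'X - (x s)%:P else polefactor s)
      else 0)).

Lemma horner_polefactor y s : (polefactor s).[y] = polefactor_at y s.
Proof. by rewrite /polefactor /polefactor_at !hornerE. Qed.

Lemma horner_cleared a k l (D : {set T}) y :
  (cleared a k l D).[y] = \sum_(A : {set T} | A \subset D)
    ((if #|A|.+1 == a then
        splitterm k l A (D :\: A) * (y ^+ k *
          \prod_(s in D) if s \in A then polefactor_at y s else y - q * x s)
      else 0) +
     (if #|A| == a then
        splitterm k l A (D :\: A) * (y ^+ l *
          \prod_(s in D) if s \in A then q * y - x s else polefactor_at y s)
      else 0)).
Proof.
rewrite horner_sum; apply: eq_bigr => A _; rewrite hornerD.
congr (_ + _); case: eqP => _; rewrite ?hornerC // hornerZ hornerM hornerXn.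
  congr (_ * (_ * _)); rewrite horner_prod; apply: eq_bigr => s _.
  by case: ifP => _; rewrite ?horner_polefactor // !hornerE.
congr (_ * (_ * _)); rewrite horner_prod; apply: eq_bigr => s _.
by case: ifP => _; rewrite ?horner_polefactor // !hornerE.
Qed.

Lemma size_polefactor s : (size (polefactor s) <= 4)%N.
Proof.
have h2 : (size ((x s)%:P - q *: 'X : {poly F})%R <= 2)%N.
  by rewrite (leq_trans (size_polyD _ _)) // geq_max size_polyN
    (leq_trans (size_polyC_leq1 _)) //= (leq_trans (size_scale_leq _ _)) // size_polyX.
rewrite /polefactor (leq_trans (size_polyMleq _ _)) //.
have := size_polyMleq ('X - (x s)%:P) ((x s)%:P - q *: 'X)%R.
rewrite !size_XsubC; move: h2.
move: (size _) (size _) => u w; lia.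
Qed.

Lemma size_prod_leq_sum (I : finType) (P : pred I) (p : I -> {poly F})
    (m : I -> nat) :
  (forall i, P i -> size (p i) <= (m i).+1)%N ->
  (size (\prod_(i | P i) p i)%R <= (\sum_(i | P i) m i).+1)%N.
Proof.
move=> pm; elim/big_rec2: _ => [|i y n Pi IH]; first by rewrite size_poly1.
by rewrite (leq_trans (size_polyMleq _ _)) //; have := pm i Pi; lia.
Qed.

(** The strict bounds on k and l express that every term of the sum tends to 0
    as the distinguished point tends to infinity. *)
Lemma size_cleared a k l (D : {set T}) :
  (a <= #|D|.+1)%N -> (k < (#|D|.+1 - a).*2)%N -> (l < a.*2)%N ->
  (size (cleared a k l D) <= 3 * #|D|)%N.
Proof.
move=> aD ka la.
have szs (A : {set T}) (m1 m2 : nat) (p1 p2 : T -> {poly F}) : A \subset D ->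
    (forall s, size (p1 s) <= m1.+1)%N -> (forall s, size (p2 s) <= m2.+1)%N ->
    (size (\prod_(s in D) if s \in A then p1 s else p2 s)%R
     <= (#|A| * m1 + (#|D| - #|A|) * m2).+1)%N.
  move=> AD h1 h2.
  have := @size_prod_leq_sum T (fun s => s \in D)
    (fun s => if s \in A then p1 s else p2 s) (fun s => if s \in A then m1 else m2).
  move/(_ _)/leq_trans; apply; first by move=> s _; case: ifP.
  rewrite ltnS (bigID (mem A)) /=.
  rewrite (eq_bigr (fun=> m1)); last by move=> s /andP[_ ->].
  rewrite [X in (_ + X)%N](eq_bigr (fun=> m2)); last by move=> s /andP[_ /negbTE->].
  rewrite !sum_nat_const; apply: eq_leq; congr (_ * _ + _ * _)%N.
    by apply: eq_card => s; rewrite unfold_in andbC; case: (boolP (s \in A)) => // /(subsetP AD)->.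
  by rewrite -cardsDS //; apply: eq_card => s; rewrite unfold_in !inE andbC.
have X2 c : (size ('X - c%:P : {poly F})%R <= 2)%N by rewrite size_XsubC.
have Q2 s : (size ((q *: 'X - (x s)%:P)%R : {poly F}) <= 2)%N.
  by rewrite (leq_trans (size_polyD _ _)) // geq_max size_polyN
    (leq_trans (size_polyC_leq1 _)) //= (leq_trans (size_scale_leq _ _)) // size_polyX.
rewrite (leq_trans (size_sum _ _ _)) //; apply/bigmax_leqP => A AD.
have cAD := subset_leq_card AD.
rewrite (leq_trans (size_polyD _ _)) // geq_max; apply/andP; split.
  case: eqP => [Aa|_]; last by rewrite size_poly0.
  rewrite (leq_trans (size_scale_leq _ _)) // (leq_trans (size_polyMleq _ _)) //.
  have := szs A 3%N 1%N polefactor (fun s => 'X - (q * x s)%:P) AD size_polefactor (fun s => X2 _).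
  by rewrite size_polyXn; lia.
case: eqP => [Aa|_]; last by rewrite size_poly0.
rewrite (leq_trans (size_scale_leq _ _)) // (leq_trans (size_polyMleq _ _)) //.
have := szs A 1%N 3%N (fun s => q *: 'X - (x s)%:P) polefactor AD Q2 size_polefactor.
by rewrite size_polyXn; move: (size _) => u; lia.
Qed.

Lemma splitsumE a k l (S : {set T}) : splitsum a k l S =
  \sum_(A : {set T} | A \subset S)
    (if #|A| == a then splitterm k l A (S :\: A) else 0).
Proof. by rewrite /splitsum -big_mkcondr. Qed.

Lemma prod_if_mulC (D A : {set T}) (f g h : T -> F) :
  (\prod_(s in D) if s \in A then f s else g s)
  * \prod_(s in D :\: A) h s
  = \prod_(s in D) if s \in A then f s else g s * h s.
Proof.
rewrite [X in _ * X](eq_bigl (fun s => (s \in D) && (s \notin A))) => [|s]; last first.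
  by rewrite !inE andbC.
rewrite big_mkcondr -big_split /=; apply: eq_bigr => s _.
by case: (s \in A); rewrite //= mulr1.
Qed.

Lemma prod_if_mul (D A : {set T}) (f g h : T -> F) : A \subset D ->
  (\prod_(s in D) if s \in A then f s else g s)
  * \prod_(s in A) h s
  = \prod_(s in D) if s \in A then f s * h s else g s.
Proof.
move=> AD; rewrite [X in _ * X](eq_bigl (fun s => (s \in D) && (s \in A))) => [|s].
  rewrite big_mkcondr -big_split /=; apply: eq_bigr => s _.
  by case: (s \in A); rewrite //= mulr1.
by case: (boolP (s \in A)) => [/(subsetP AD)->|]; rewrite ?andbT ?andbF.
Qed.

Lemma splitsum_gt a k l (S : {set T}) : (#|S| < a)%N -> splitsum a k l S = 0.
Proof.
move=> aS; apply: big_pred0 => A; apply/negbTE/negP => /andP[/subset_leq_card AS /eqP].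
by move: AS aS; lia.
Qed.

Lemma splitsum0 k l (S : {set T}) : splitsum 0 k l S = setpow l S.
Proof.
rewrite /splitsum (big_pred1 set0) => [|A].
  by rewrite /splitterm /setpow /pairwS !big_set0 setD0 mulr1 mul1r.
by rewrite cards_eq0 andb_idl // => /eqP->; rewrite sub0set.
Qed.

Lemma splitsum_full k l (S : {set T}) : splitsum #|S| k l S = setpow k S.
Proof.
rewrite /splitsum (big_pred1 S) => [|A].
  rewrite /splitterm /setpow /pairwS setDv big_set0 mulr1 [X in _ * X]big1 ?mulr1 //.
  by move=> s _; rewrite big_set0.
by rewrite /= eqEcard; apply: andb_id2l => /subset_leq_card AS; lia.
Qed.

Lemma cardsD1_pair i j (S : {set T}) :
  i \in S -> j \in S :\ i -> #|S| = #|S :\ i :\ j|.+2.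
Proof. by move=> iS jS; rewrite (cardsD1 i) iS (cardsD1 j) jS. Qed.

Lemma splitsum_pair k l i j : i != j ->
  splitsum 1 k l [set i; j]
  = x i ^ k * x j ^ l * pairw (x i) (x j) + x j ^ k * x i ^ l * pairw (x j) (x i).
Proof.
move=> ij.
have termE u v : x u ^ k * x v ^ l * pairw (x u) (x v)
    = splitterm k l [set u] [set v].
  by rewrite /splitterm /setpow /pairwS !big_set1.
rewrite !termE.
have ->: splitterm k l [set j] [set i]
    = splitterm k l [set j] ([set i; j] :\: [set j]).
  by rewrite setUC setU1K // in_set1 eq_sym.
rewrite splitsumE (sum_subsets_setD1 _ (set21 i j)) setU1K ?in_set1 //.
rewrite (sum_subsets_setD1 _ (set11 j)) setDv.
rewrite (big_pred1 set0) => [|A]; last by rewrite subset0.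
by rewrite !setU0 cards2 ij cards0 !cards1 /= addr0 add0r addrC ?setU1K ?in_set1.
Qed.

Hypothesis q_neq0 : q != 0.
(** Three conditions in one: the points are nonzero and q is not a root of unity
    (take i = j), and the ratio of two distinct points is not a power of q. *)
Hypothesis x_gen : forall i j k, x i = q ^+ k * x j -> i = j /\ k = 0%N.

Lemma gen_neq0 i : x i != 0.
Proof. by apply/eqP=> xi0; have [] := @x_gen i i 1 _; rewrite // xi0 mulr0. Qed.

Lemma gen_expq_neq i j k : (i != j) || (0 < k)%N -> x i - q ^+ k * x j != 0.
Proof.
move=> ijk; rewrite subr_eq0; apply/eqP => /x_gen[ij k0]; move: ijk.
by rewrite ij k0 eqxx.
Qed.

Lemma pairw_neq0 i j : i != j -> [&& x i - x j != 0, x j - x i != 0,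
  x i - q * x j != 0 & x j - q * x i != 0].
Proof.
move=> ij; have := @gen_expq_neq i j 0; have := @gen_expq_neq j i 0.
have := @gen_expq_neq i j 1; have := @gen_expq_neq j i 1.
by rewrite !expr0 !mul1r !expr1 !orbT [j == i]eq_sym ij => -> // -> // -> // ->.
Qed.

Lemma horner_cleared_self a (k l : nat) i (S : {set T}) : i \in S ->
  (cleared a k l (S :\ i)).[x i]
  = (\prod_(s in S :\ i) polefactor_at (x i) s) * splitsum a k l S.
Proof.
move=> iS; rewrite horner_cleared splitsumE (sum_subsets_setD1 _ iS) mulr_sumr.
apply: eq_bigr => A; rewrite subsetD1 => /andP[AS iA].
have AD : A \subset S :\ i by rewrite subsetD1 AS.
rewrite cardsU1 iA add1n mulrDr; congr (_ + _); case: eqP => _; rewrite ?mulr0 //.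
  have -> : S :\: (i |: A) = (S :\ i) :\: A by rewrite setDDl.
  rewrite splitterm_addl // exprnP.
  suff -> : \prod_(s in S :\ i) (if s \in A then polefactor_at (x i) s else x i - q * x s)
      = (\prod_(s in S :\ i) polefactor_at (x i) s)
        * \prod_(t in (S :\ i) :\: A) pairw (x i) (x t) by ring.
  rewrite [X in _ = X * _](eq_bigr (fun s =>
    if s \in A then polefactor_at (x i) s else polefactor_at (x i) s));
    last by move=> s _; case: ifP.
  rewrite prod_if_mulC; apply: eq_bigr => s sD; case: ifP => // _.
  have /setD1P[/pairw_neq0/and4P[_ h1 h2 _] _] := sD.
  by rewrite /polefactor_at /pairw; field; rewrite h1 h2.
have -> : S :\: A = i |: ((S :\ i) :\: A).
  apply/setP=> s; rewrite !inE; case: (eqVneq s i) => [->|] //=.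
  by rewrite iA iS.
rewrite splitterm_addr; last by rewrite !inE eqxx andbF.
rewrite exprnP.
suff -> : \prod_(s in S :\ i) (if s \in A then q * x i - x s else polefactor_at (x i) s)
    = (\prod_(s in S :\ i) polefactor_at (x i) s) * \prod_(s in A) pairw (x s) (x i) by ring.
rewrite [X in _ = X * _](eq_bigr (fun s =>
    if s \in A then polefactor_at (x i) s else polefactor_at (x i) s));
  last by move=> s _; case: ifP.
rewrite prod_if_mul //; apply: eq_bigr => s sD; case: ifP => // _.
have /setD1P[/pairw_neq0/and4P[h1 _ _ h2] _] := sD.
by rewrite /polefactor_at /pairw; field; rewrite h1 h2.
Qed.

(** When i and j lie on the same side of the splitting, the term keeps the whole
    pole factor of j and vanishes.  The two placements of i and j on opposite
    sides are grouped under the splitting of the other points. *)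
Lemma horner_cleared_root a (k l : nat) j (D : {set T}) y :
  j \in D -> polefactor_at y j = 0 ->
  (cleared a.+1 k l D).[y] = \sum_(A : {set T} | A \subset D :\ j)
    (if #|A| == a then splitterm k l A ((D :\ j) :\: A) *
       (x j ^+ l * y ^+ k * (y - q * x j) *
         (\prod_(s in D :\ j)
            if s \in A then polefactor_at y s * pairw (x s) (x j) else y - q * x s)
        + x j ^+ k * y ^+ l * (q * y - x j) *
         (\prod_(s in D :\ j)
            if s \in A then q * y - x s else polefactor_at y s * pairw (x j) (x s)))
     else 0).
Proof.
move=> jD yj; rewrite horner_cleared (sum_subsets_setD1 _ jD).
apply: eq_bigr => A; rewrite subsetD1 => /andP[AD jA].
have AD' : A \subset D :\ j by rewrite subsetD1 AD.
rewrite cardsU1 jA add1n !eqSS.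
have z1 (g : T -> F) :
    \prod_(s in D) (if s \in j |: A then polefactor_at y s else g s) = 0.
  by rewrite (bigD1 j jD) /= setU11 yj mul0r.
have z2 (g : T -> F) :
    \prod_(s in D) (if s \in A then g s else polefactor_at y s) = 0.
  by rewrite (bigD1 j jD) /= (negbTE jA) yj mul0r.
have splitj (g : T -> F) : \prod_(s in D) g s = g j * \prod_(s in D :\ j) g s.
  by rewrite (big_setD1 j jD).
rewrite z1 z2 !mulr0 !if_same add0r addr0 !splitj (negbTE jA) setU11.
case: eqP => _; last by rewrite addr0.
have -> : D :\: (j |: A) = (D :\ j) :\: A by rewrite setDDl.
have -> : D :\: A = j |: ((D :\ j) :\: A).
  by apply/setP=> s; rewrite !inE; case: (eqVneq s j) => [->|] //=; rewrite jA jD.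
rewrite splitterm_addl // splitterm_addr; last by rewrite !inE eqxx andbF.
have -> : \prod_(s in D :\ j) (if s \in j |: A then q * y - x s else polefactor_at y s)
    = \prod_(s in D :\ j) (if s \in A then q * y - x s else polefactor_at y s).
  apply: eq_bigr => s; rewrite !inE => /andP[sj _]; by rewrite (negbTE sj).
rewrite -(prod_if_mulC _ _ (fun s => q * y - x s) (polefactor_at y)).
rewrite -(prod_if_mul (polefactor_at y) (fun s => y - q * x s)) // !exprnP.
ring.
Qed.

(** The poles on the diagonal cancel: at x j, the two placements of i and j on
    opposite sides give opposite contributions. *)
Lemma horner_cleared_eq a (k l : nat) j (D : {set T}) : j \in D ->
  (cleared a.+1 k l D).[x j] = 0.
Proof.
move=> jD; rewrite (horner_cleared_root _ _ _ jD); last by rewrite /polefactor_at subrr !mul0r.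
apply: big1 => A AD; case: eqP => // _.
suff -> : \prod_(s in D :\ j)
    (if s \in A then q * x j - x s else polefactor_at (x j) s * pairw (x j) (x s))
  = \prod_(s in D :\ j)
    (if s \in A then polefactor_at (x j) s * pairw (x s) (x j) else x j - q * x s) by ring.
apply: eq_bigr => s /setD1P[/pairw_neq0/and4P[h1 h2 h3 h4] _].
by rewrite /polefactor_at /pairw; case: ifP => _; field; rewrite ?h1 ?h2 ?h3 ?h4.
Qed.

(** Only the placement with j in A and i in B has a pole where the value at i is
    q * x j.  The weights of the pair against any other point s then telescope to
    the same factor, up to a power of q, whether s is in A or in B; this is why
    the residue is again a sum over splittings. *)
Lemma horner_cleared_q a (k l : nat) j (D : {set T}) : j \in D ->
  (cleared a.+1 k l D).[q * x j]
  = x j ^+ (k + l) * (q ^+ 2 * x j - x j) * q ^+ (#|D|.-1)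
    * (\prod_(s in D :\ j) (q ^+ 2 * x j - x s))
    * (q ^+ l / q ^+ a * splitsum a k l (D :\ j)).
Proof.
move=> jD; rewrite (horner_cleared_root _ _ _ jD); last by rewrite /polefactor_at subrr !mulr0.
rewrite splitsumE !mulr_sumr.
apply: eq_bigr => A AD; case: eqP => [Aa|_]; last by rewrite !mulr0.
suff -> : \prod_(s in D :\ j)
    (if s \in A then q * (q * x j) - x s
     else polefactor_at (q * x j) s * pairw (x j) (x s))
  = q ^+ (#|D|.-1) / q ^+ a * \prod_(s in D :\ j) (q ^+ 2 * x j - x s).
  by rewrite exprD !exprMn; ring.
have -> : q ^+ (#|D|.-1) / q ^+ a = \prod_(s in D :\ j) if s \in A then 1 else q.
  under [RHS]eq_bigr do rewrite -if_neg.
  rewrite -big_mkcondl /= (eq_bigl (mem ((D :\ j) :\: A))); last first.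
    by move=> s; rewrite !inE.
  rewrite prodr_const cardsDS // Aa (cardsD1 j D) jD add1n /= -expfB_cond //.
  by rewrite (negbTE q_neq0) add0n -Aa; exact: (subset_leq_card AD).
rewrite -big_split; apply: eq_bigr => s /setD1P[/pairw_neq0/and4P[_ h1 h2 _] _] /=.
case: ifP => _; first by ring.
by rewrite /polefactor_at /pairw; field; rewrite h1 h2.
Qed.

(** The mirror case: the pole comes from the placement with i in A and j in B.
    The last factor agrees with the one at q * x j, so one linear relation makes
    a combination vanish at both points. *)
Lemma horner_cleared_qV a (k l : nat) j (D : {set T}) : j \in D ->
  (cleared a.+1 k l D).[q^-1 * x j]
  = x j ^+ (k + l) * (q^-1 * x j - q * x j) / q ^+ (k + l)
    * (\prod_(s in D :\ j) (q^-1 * x j - q * x s))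
    * (q ^+ l / q ^+ a * splitsum a k l (D :\ j)).
Proof.
move=> jD; rewrite (horner_cleared_root _ _ _ jD); last first.
  by rewrite /polefactor_at mulVKf // subrr mulr0 mul0r.
rewrite splitsumE !mulr_sumr.
apply: eq_bigr => A AD; case: eqP => [Aa|_]; last by rewrite !mulr0.
suff -> : \prod_(s in D :\ j)
    (if s \in A then polefactor_at (q^-1 * x j) s * pairw (x s) (x j)
     else q^-1 * x j - q * x s)
  = (q ^+ a)^-1 * \prod_(s in D :\ j) (q^-1 * x j - q * x s).
  by rewrite !exprD !exprMn !exprVn; field; rewrite !expf_neq0.
have -> : (q ^+ a)^-1 = \prod_(s in D :\ j) if s \in A then q^-1 else 1.
  rewrite -big_mkcondl /= (eq_bigl (mem A)); last first.
    by move=> s; rewrite /= andb_idr //; exact: (subsetP AD).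
  by rewrite prodr_const Aa exprVn.
rewrite -big_split; apply: eq_bigr => s /setD1P[/pairw_neq0/and4P[h1 _ _ h2] _] /=.
case: ifP => _; last by ring.
by rewrite /polefactor_at /pairw; field; rewrite q_neq0 h1 h2.
Qed.

(** A quadruple (c, a, k, l) stands for c * splitsum a k l; lexp and rexp are the
    exponents on the two sides of the splitting. *)
Local Notation summand := (F * nat * nat * nat)%type.

Definition coef (t : summand) := t.1.1.1.
Definition blk (t : summand) := t.1.1.2.
Definition lexp (t : summand) := t.1.2.
Definition rexp (t : summand) := t.2.

Definition lincomb (ts : seq summand) (S : {set T}) : F :=
  \sum_(t <- ts) coef t * splitsum (blk t) (lexp t) (rexp t) S.

Definition residue (t : summand) : summand :=
  (coef t * (q ^+ rexp t / q ^+ (blk t).-1), (blk t).-1, lexp t, rexp t).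

(** The first condition makes all the summands homogeneous of one degree e, so
    that their residues share the power of x j that horner_cleared_q and
    horner_cleared_qV extract. *)
Definition admissible (n e : nat) (t : summand) : bool :=
  [&& lexp t + rexp t == e, lexp t < (n - blk t).*2 & rexp t < (blk t).*2]%N.

(** The polynomial obtained by clearing denominators has degree less than
    3 * (#|S| - 1), and it vanishes at x j, q * x j and q^-1 * x j for each of the
    other #|S| - 1 points j, hence it is 0. *)
Lemma lincomb_vanish (ts : seq summand) e (S : {set T}) i :
  i \in S -> all (admissible #|S| e) ts ->
  (forall j, j \in S :\ i -> lincomb (map residue ts) (S :\ i :\ j) = 0) ->
  lincomb ts S = 0.
Proof.
move=> iS /allP adm res0; set D := S :\ i.
have cS : #|S| = #|D|.+1 by rewrite (cardsD1 i S) iS.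
pose P := \sum_(t <- ts) coef t *: cleared (blk t) (lexp t) (rexp t) D.
have hornerP y : P.[y]
    = \sum_(t <- ts) coef t * (cleared (blk t) (lexp t) (rexp t) D).[y].
  by rewrite horner_sum; apply: eq_bigr => t _; rewrite hornerZ.
have blk_gt0 t : t \in ts -> blk t = (blk t).-1.+1.
  by move=> /adm /and3P[_ _]; case: (blk t) => //; rewrite ltn0.
have sizeP : (size P <= 3 * #|D|)%N.
  rewrite /P big_seq (leq_trans (size_sum _ _ _)) //; apply/bigmax_leqP_seq => t tts _.
  rewrite (leq_trans (size_scale_leq _ _)) //.
  have /and3P[_ k_lt l_lt] := adm t tts; move: k_lt; rewrite cS => k_lt.
  by apply: size_cleared => //; move: k_lt; lia.
pose rs := [seq x j | j <- enum D] ++ [seq q * x j | j <- enum D]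
           ++ [seq q^-1 * x j | j <- enum D].
have x_inj : injective x.
  by move=> j j' jj'; have [] := @x_gen j j' 0 _; rewrite // mul1r.
have rs_uniq : uniq rs.
  rewrite !cat_uniq !map_inj_uniq ?enum_uniq //=; first last.
  - by move=> j j' /(mulfI q_neq0)/x_inj.
  - by move=> j j' /(mulfI (invr_neq0 q_neq0))/x_inj.
  rewrite andbT has_cat negb_or; apply/andP; split; first (apply/andP; split).
  - apply/hasPn => _ /mapP[j _ ->]; apply/mapP => -[j' _].
    by move=> /esym; rewrite -{1}[q]expr1 => /x_gen[].
  - apply/hasPn => _ /mapP[j _ ->]; apply/mapP => -[j' _].
    by move/(congr1 ( *%R q)); rewrite mulVKf // -[X in _ = X * _]expr1 => /x_gen[].
  - apply/hasPn => _ /mapP[j _ ->]; apply/mapP => -[j' _].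
    by move/(congr1 ( *%R q)); rewrite mulVKf // mulrA -expr2 => /x_gen[].
have rs_root : all (root P) rs.
  have lin (c y : F) j : j \in D ->
      (forall t, t \in ts -> (cleared (blk t) (lexp t) (rexp t) D).[y]
         = c * (q ^+ rexp t / q ^+ (blk t).-1
                * splitsum (blk t).-1 (lexp t) (rexp t) (D :\ j))) ->
      root P y.
    move=> jD val; have := res0 j jD; rewrite /lincomb big_map /= => res0j.
    apply/eqP; rewrite hornerP; apply: etrans (mulr0 c).
    rewrite -[in RHS]res0j mulr_sumr; apply: eq_big_seq => t tts.
    by rewrite val // /residue /coef /blk /lexp /rexp /=; ring.
  rewrite !all_cat; apply/and3P; split; apply/allP => _ /mapP[j + ->];
    rewrite mem_enum => jD.
  - apply: (@lin 0 _ _ jD) => t tts.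
    by rewrite {1}blk_gt0 // horner_cleared_eq // mul0r.
  - apply: (lin _ _ _ jD) => t tts.
    rewrite {1}blk_gt0 // horner_cleared_q //.
    by have /and3P[/eqP-> _ _] := adm t tts.
  - apply: (lin _ _ _ jD) => t tts.
    rewrite {1}blk_gt0 // horner_cleared_qV //.
    by have /and3P[/eqP-> _ _] := adm t tts.
have P0 : P = 0.
  apply/eqP/negPn/negP => Pn0; have := max_poly_roots Pn0 rs_root rs_uniq.
  move=> /leq_trans/(_ sizeP); rewrite /rs !size_cat !size_map -cardE; lia.
have dn0 : \prod_(s in D) polefactor_at (x i) s != 0.
  rewrite prodf_seq_neq0; apply/allP => s _; apply/implyP; rewrite !inE => /andP[si _].
  rewrite !mulf_neq0 //; try by rewrite -[q]expr1; apply: gen_expq_neq; rewrite orbT.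
  by have := @gen_expq_neq i s 0; rewrite expr0 mul1r; apply; rewrite eq_sym si.
apply: (mulfI dn0); rewrite mulr0 mulr_sumr -[RHS](horner0 (x i)) -P0 hornerP.
by apply: eq_bigr => t _; rewrite horner_cleared_self //; ring.
Qed.

Lemma splitterm_shift t k l (S A : {set T}) : A \subset S ->
  splitterm (k + t) (l + t) A (S :\: A)
  = setpow t S * splitterm k l A (S :\: A).
Proof.
move=> AS; rewrite /splitterm /setpow.
rewrite (eq_bigr (fun s => x s ^ k * x s ^ t)); last first.
  by move=> s _; rewrite expfzDr ?gen_neq0.
rewrite [X in _ * X * _](eq_bigr (fun s => x s ^ l * x s ^ t)); last first.
  by move=> s _; rewrite expfzDr ?gen_neq0.
rewrite !big_split /= [in RHS](big_setID A) /= (setIidPr AS); ring.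
Qed.

(** Only the difference of the two exponents matters, which reduces integer
    exponents to small natural ones. *)
Lemma splitsum_shift t a k l (S : {set T}) :
  splitsum a (k + t) (l + t) S = setpow t S * splitsum a k l S.
Proof.
rewrite /splitsum mulr_sumr; apply: eq_bigr => A /andP[AS _].
exact: splitterm_shift.
Qed.

(** Under these bounds on k and l the summands stay admissible all along the
    induction: b - a is constant, and k < 2 * b, l < 2 * a hold as long as a is
    positive. *)
Lemma splitsum_comm_nat a b k l m (S : {set T}) :
  (a <= b)%N -> #|S| = (a + b)%N -> (k <= (b - a).*2.+1)%N -> (l <= 1)%N ->
  k%:Z - l%:Z = b%:Z - a%:Z - m ->
  q ^ (- (m * a%:Z)) * splitsum a k l S = splitsum b l k S.
Proof.
elim: a b S => [|a IH] b S ab cS k_le l_le klm.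
  by rewrite mulr0 oppr0 expr0z mul1r splitsum0 -[b]add0n -cS splitsum_full.
case: b ab cS k_le klm => // b ab cS k_le klm.
have [i iS] : exists i, i \in S by apply/set0Pn; rewrite -card_gt0 cS.
suff : lincomb [:: (q ^ (- (m * a.+1%:Z)), a.+1, k, l); (-1, b.+1, l, k)] S = 0.
  rewrite /lincomb !big_cons big_nil /coef /blk /lexp /rexp /= addr0 mulN1r.
  by move/eqP; rewrite subr_eq0 => /eqP.
apply: (@lincomb_vanish _ (k + l)%N _ i) => //.
  rewrite /admissible /blk /lexp /rexp /= cS; lia.
move=> j jD; rewrite /lincomb !big_cons big_nil /residue /coef /blk /lexp /rexp /=.
have cD : #|S :\ i :\ j| = (a + b)%N.
  by have := cardsD1_pair iS jD; rewrite cS; lia.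
rewrite -(IH b (S :\ i :\ j)) //; last by lia.
have -> : q ^ (- (m * a.+1%:Z)) * (q ^+ l / q ^+ a)
    = q ^+ k / q ^+ b * q ^ (- (m * a)).
  rewrite !exprnP !invr_expz -!expfzDr //; congr (_ ^ _); lia.
by ring.
Qed.

(** The identity behind the commutation of two operators whose second indices
    differ by m; a and b count the elements of their index sets outside C. *)
Lemma splitsum_comm a b (e f m : int) (S : {set T}) :
  (a <= b)%N -> #|S| = (a + b)%N -> `|m| <= b%:Z - a%:Z + 1 ->
  e - f = b%:Z - a%:Z - m ->
  q ^ (- (m * a%:Z)) * splitsum a e f S = splitsum b f e S.
Proof.
move=> ab cS m_le efm.
have [t [k [l [e_eq f_eq k_le l_le]]]] : exists t : int, exists k l : nat,
    [/\ e = k%:Z + t, f = l%:Z + t, (k <= (b - a).*2.+1)%N & (l <= 1)%N].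
  have [fe|ef] := boolP (f <= e)%R.
    by exists f, `|e - f|%N, 0%N; split; lia.
  by exists e, 0%N, `|f - e|%N; split; lia.
rewrite e_eq f_eq !splitsum_shift mulrCA (@splitsum_comm_nat a b) //.
lia.
Qed.

(** For a = 1 the first summand does not tend to 0 at infinity, so this case is
    computed directly and the induction starts at a = 2. *)
Lemma splitsum_qsys_nat a (S : {set T}) : #|S| = a.*2 ->
  q ^+ a * splitsum a 2 0 S = splitsum a 1 1 S - splitsum a.+1 0 2 S.
Proof.
elim: a S => [|[|a] IH] S cS.
- rewrite !splitsum0 mul1r splitsum_gt ?cS // subr0.
  by rewrite (cards0_eq cS) /setpow !big_set0.
- have /eqP/cards2P[i [j [ij S_ij]]] : #|S| = 2%N by rewrite cS.
  have -> : splitsum 2%N 0 2 S = 1.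
    by rewrite -[2%N]cS splitsum_full /setpow big1 // => s _; rewrite expr0z.
  have /and4P[h1 h2 h3 h4] := pairw_neq0 ij.
  rewrite S_ij !splitsum_pair // -!exprnP /pairw; field.
  by rewrite h1 h2 h3 h4.
- have [i iS] : exists i, i \in S by apply/set0Pn; rewrite -card_gt0 cS.
  suff : lincomb [:: (q ^+ a.+2, a.+2, 2%N, 0%N);
    (-1, a.+2, 1%N, 1%N); (1, a.+3, 0%N, 2%N)] S = 0.
    rewrite /lincomb !big_cons big_nil /coef /blk /lexp /rexp /= addr0 mulN1r mul1r.
    by move/eqP; rewrite addr_eq0 => /eqP->; rewrite opprD opprK.
  apply: (@lincomb_vanish _ 2 _ i) => //.
    rewrite /admissible /blk /lexp /rexp /= cS; lia.
  move=> j jD; rewrite /lincomb !big_cons big_nil /residue /coef /blk /lexp /rexp /=.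
  have cD : #|S :\ i :\ j| = a.+1.*2.
    by have := cardsD1_pair iS jD; rewrite cS; lia.
  have /eqP := IH _ cD; rewrite -subr_eq opprK => /eqP<-.
  rewrite !exprS; field; by rewrite expf_neq0.
Qed.

Lemma splitsum_qsys_dual_nat a (S : {set T}) : #|S| = a.*2 ->
  splitsum a 0 2 S / q ^+ a = splitsum a 1 1 S - splitsum a.+1 0 2 S / q.
Proof.
elim: a S => [|[|a] IH] S cS.
- rewrite !splitsum0 divr1 splitsum_gt ?cS // mul0r subr0.
  by rewrite (cards0_eq cS) /setpow !big_set0.
- have /eqP/cards2P[i [j [ij S_ij]]] : #|S| = 2%N by rewrite cS.
  have -> : splitsum 2%N 0 2 S = 1.
    by rewrite -[2%N]cS splitsum_full /setpow big1 // => s _; rewrite expr0z.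
  have /and4P[h1 h2 h3 h4] := pairw_neq0 ij.
  rewrite S_ij !splitsum_pair // -!exprnP /pairw; field.
  by rewrite q_neq0 h1 h2 h3 h4.
- have [i iS] : exists i, i \in S by apply/set0Pn; rewrite -card_gt0 cS.
  suff : lincomb [:: ((q ^+ a.+2)^-1, a.+2, 0%N, 2%N);
    (-1, a.+2, 1%N, 1%N); (q^-1, a.+3, 0%N, 2%N)] S = 0.
    rewrite /lincomb !big_cons big_nil /coef /blk /lexp /rexp /= addr0 mulN1r.
    by move/eqP; rewrite addr_eq0 mulrC => /eqP->; rewrite opprD opprK [q^-1 * _]mulrC.
  apply: (@lincomb_vanish _ 2 _ i) => //.
    rewrite /admissible /blk /lexp /rexp /= cS; lia.
  move=> j jD; rewrite /lincomb !big_cons big_nil /residue /coef /blk /lexp /rexp /=.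
  have cD : #|S :\ i :\ j| = a.+1.*2.
    by have := cardsD1_pair iS jD; rewrite cS; lia.
  have /eqP := IH _ cD; rewrite -subr_eq opprK => /eqP<-.
  rewrite !exprS; field; by rewrite q_neq0 expf_neq0.
Qed.

(** The identity behind the exchange relation.  In the products
    D_(b,n+1) D_(b,n-1) and D_(b,n) D_(b,n), the index sets split S into two parts
    of equal size a; in D_(b+1,n) D_(b-1,n) the parts have sizes a + 1 and a - 1. *)
Lemma splitsum_qsys a (e : int) (S : {set T}) : #|S| = a.*2 ->
  q ^+ a * splitsum a (e + 1) (e - 1) S
  = splitsum a e e S - splitsum a.+1 (e - 1) (e + 1) S.
Proof.
move=> cS; have := splitsum_qsys_nat cS.
move/(congr1 (fun u => setpow (e - 1) S * u)); rewrite mulrBr mulrCA -!splitsum_shift.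
by rewrite !add0r [1 + _]addrC subrK [2%:Z + _]addrC -[2%:Z]/(1 + 1 : int) addrA subrK.
Qed.

Lemma splitsum_qsys_dual a (e : int) (S : {set T}) : #|S| = a.*2 ->
  splitsum a (e - 1) (e + 1) S / q ^+ a
  = splitsum a e e S - splitsum a.+1 (e - 1) (e + 1) S / q.
Proof.
move=> cS; have := splitsum_qsys_dual_nat cS.
move/(congr1 (fun u => setpow (e - 1) S * u)); rewrite mulrBr !mulrA -!splitsum_shift.
by rewrite !add0r [1 + _]addrC subrK [2%:Z + _]addrC -[2%:Z]/(1 + 1 : int) addrA subrK.
Qed.

End SplitSums.

(** * Automorphisms of the field of rational functions *)

Lemma fraction_numden (R : idomainType) (f : {fraction R}) :
  f = (\n_(repr f))%:F / (\d_(repr f))%:F.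
Proof.
have d0 : (\d_(repr f))%:F != 0 :> {fraction R} by rewrite tofrac_eq0 denom_ratioP.
apply: (mulIf d0); rewrite mulfVK //.
rewrite -{1}[f]reprK; unlock FracField.tofrac; rewrite -[LHS]FracField.pi_mul.
apply/eqmodP; rewrite /= FracField.equivfE /FracField.mulf.
by rewrite !numden_Ratio ?mulf_neq0 ?oner_neq0 ?denom_ratioP // !mulr1 mulrC.
Qed.

Lemma mpoly_rmorph_ext (n : nat) (R : nzRingType) (S : nzRingType)
    (g h : {rmorphism {mpoly R[n]} -> S}) :
  (forall c, g c%:MP = h c%:MP) -> (forall i, g 'X_i = h 'X_i) -> g =1 h.
Proof.
move=> ghC ghX p; rewrite [p]mpolyE !rmorph_sum; apply: eq_bigr => m _ /=.
rewrite -mul_mpolyC !rmorphM ghC mpolyXE_id !rmorph_prod; congr (_ * _).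
by apply: eq_bigr => i _; rewrite !rmorphXn /= ghX.
Qed.

Lemma mpolyXU_neq0 (n : nat) (R : nzRingType) (i : 'I_n) :
  'X_i != 0 :> {mpoly R[n]}.
Proof.
apply/eqP => /(congr1 (mcoeff U_(i)))/eqP.
by rewrite mcoeffX mcoeff0 eqxx oner_eq0.
Qed.

Section Torus.

Variables (K : fieldType) (r : nat).
Local Notation F := (ratfun K r).
Local Notation cst := (@cst K r).
Local Notation z := (@z K r).

Lemma cst_zmod : zmod_morphism cst.
Proof. by move=> a b; rewrite /Defs.cst !rmorphB. Qed.
Lemma cst_monoid : monoid_morphism cst.
Proof. by split=> [|a b]; rewrite /Defs.cst ?rmorph1 // !rmorphM. Qed.
HB.instance Definition _ := GRing.isZmodMorphism.Build K F cst cst_zmod.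
HB.instance Definition _ := GRing.isMonoidMorphism.Build K F cst cst_monoid.

Lemma z_lift (j : 'I_r) : z (lift ord_max j) = ('X_j)%:F.
Proof. by rewrite /Defs.z liftK. Qed.

Lemma z_max : z ord_max = (\prod_(j < r) z (lift ord_max j))^-1.
Proof.
rewrite /Defs.z unlift_none; congr (_ ^-1); apply: eq_bigr => j _.
by rewrite liftK.
Qed.

Lemma z_neq0 i : z i != 0.
Proof.
case: (unliftP ord_max i) => [j|] ->.
  by rewrite z_lift tofrac_eq0 mpolyXU_neq0.
rewrite z_max invr_eq0 prodf_seq_neq0; apply/allP => j _.
by rewrite z_lift tofrac_eq0 mpolyXU_neq0.
Qed.

Lemma prod_z : \prod_i z i = 1.
Proof.
rewrite (bigD1_ord ord_max) //= z_max mulVf // prodf_seq_neq0.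
by apply/allP => j _; rewrite z_neq0.
Qed.

(** A property of a bare function, because the shifts are defined by evaluation
    and are morphisms only by a theorem (torus_ev). *)
Definition torus (c : 'I_r.+1 -> K) (h : F -> F) : Prop :=
  exists g : {rmorphism F -> F},
    [/\ g =1 h, forall a, g (cst a) = cst a & forall j, g (z j) = cst (c j) * z j].

Lemma torus_id : torus (fun=> 1) id.
Proof. by exists idfun; split=> // j; rewrite /= rmorph1 mul1r. Qed.

Lemma torus_comp c d g h : torus c g -> torus d h ->
  torus (fun j => c j * d j) (g \o h).
Proof.
move=> [g' [gE gC gZ]] [h' [hE hC hZ]]; exists (g' \o h'); split=> [f|a|j] /=.
- by rewrite hE gE.
- by rewrite hC gC.
- by rewrite hZ rmorphM gC gZ rmorphM mulrCA mulrA.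
Qed.

Lemma torus_uniq c d g h : torus c g -> torus d h -> c =1 d -> g =1 h.
Proof.
move=> [g' [gE gC gZ]] [h' [hE hC hZ]] cd f; rewrite -gE -hE.
have ext (p : {mpoly K[r]}) : g' p%:F = h' p%:F.
  apply: (@mpoly_rmorph_ext _ _ _ (g' \o @tofrac _) (h' \o @tofrac _)) => [a|j] /=.
    by rewrite -[_%:F]/(cst a) gC hC.
  by rewrite -z_lift gZ hZ cd.
by rewrite [f]fraction_numden !fmorph_div !ext.
Qed.

Section Evaluation.

Variable c : 'I_r.+1 -> K.
Hypothesis c_neq0 : forall j, c j != 0.
Hypothesis prod_c : \prod_j c j = 1.

Let x (j : 'I_r.+1) : F := cst (c j) * z j.
Let evpoly : {rmorphism {mpoly K[r]} -> F} := mmap cst (fun j => x (lift ord_max j)).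

(** The substitution is undone by the scaling with inverse factors, so the
    denominators never vanish and the evaluation is well defined on fractions. *)
Lemma evpoly_inj (p : {mpoly K[r]}) : evpoly p = 0 -> p = 0.
Proof.
pose sub (e : 'I_r -> K) : {rmorphism {mpoly K[r]} -> {mpoly K[r]}} :=
  mmap (@mpolyC r K) (fun j => (e j)%:MP * 'X_j).
pose d (j : 'I_r) := c (lift ord_max j).
have phiE : evpoly p = (sub d p)%:F.
  apply: (@mpoly_rmorph_ext _ _ _ evpoly (@tofrac _ \o sub d)) => [a|j] /=.
    by rewrite !mmapC.
  by rewrite !mmapX !mmap1U /x z_lift rmorphM.
move/eqP; rewrite phiE tofrac_eq0 => /eqP sub0.
have <- : sub (fun j => (d j)^-1) (sub d p) = p.
  apply: (@mpoly_rmorph_ext _ _ _ (sub _ \o sub d) idfun) => [a|j] /=.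
    by rewrite !mmapC.
  rewrite mmapX mmap1U rmorphM /= mmapC mmapX mmap1U mulrA -rmorphM.
  by rewrite mulfV ?rmorph1 ?mul1r ?c_neq0.
by rewrite sub0 rmorph0.
Qed.

Lemma evpoly_neq0 (p : {mpoly K[r]}) : p != 0 -> evpoly p != 0.
Proof. by apply: contra_neq; exact: evpoly_inj. Qed.

Lemma ev_frac (n d : {mpoly K[r]}) : d != 0 -> ev x (n%:F / d%:F) = evpoly n / evpoly d.
Proof.
move=> d0; set f := _ / _.
have -> : ev x f = evpoly \n_(repr f) / evpoly \d_(repr f) by [].
have := fraction_numden f; rewrite {1}/f => /eqP.
rewrite eqr_div ?tofrac_eq0 ?denom_ratioP // -!rmorphM tofrac_eq => /eqP nd.
apply/eqP; rewrite eqr_div ?evpoly_neq0 ?denom_ratioP //.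
by rewrite -!rmorphM -nd mulrC.
Qed.

(** That z ord_max is scaled by c ord_max is where the product of the c j being 1
    is used. *)
Lemma torus_ev : torus c (ev x).
Proof.
have evB : zmod_morphism (ev x).
  move=> f g; rewrite [f]fraction_numden [g]fraction_numden.
  set n1 := \n_ _; set d1 := \d_ _; set n2 := \n_ _; set d2 := \d_ _.
  have d10 : d1 != 0 by exact: denom_ratioP.
  have d20 : d2 != 0 by exact: denom_ratioP.
  rewrite -mulNr -rmorphN addf_div ?tofrac_eq0 // -!rmorphM -rmorphD.
  rewrite !ev_frac ?mulf_neq0 // rmorphD !rmorphM rmorphN -mulNr.
  by rewrite [RHS]addf_div ?evpoly_neq0.
have evM : monoid_morphism (ev x).
  split=> [|f g].
    by have := @ev_frac 1 1 (oner_neq0 _); rewrite !rmorph1 !divr1.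
  rewrite [f]fraction_numden [g]fraction_numden mulf_div -!rmorphM.
  by rewrite !ev_frac ?mulf_neq0 ?denom_ratioP // !rmorphM mulf_div.
pose ev1 := GRing.isZmodMorphism.Build F F (ev x) evB.
pose ev2 := GRing.isMonoidMorphism.Build F F (ev x) evM.
pose g : {rmorphism F -> F} := HB.pack (ev x) ev1 ev2.
have gpoly (p : {mpoly K[r]}) : g p%:F = evpoly p.
  have := @ev_frac p 1 (oner_neq0 _).
  by rewrite !rmorph1 !divr1.
have gz j : g (z (lift ord_max j)) = x (lift ord_max j).
  by rewrite {1}z_lift gpoly /evpoly /= mmapX mmap1U.
exists g; split=> // [a|j].
  by rewrite -[cst a]/(_%:F) gpoly /evpoly /= mmapC.
case: (unliftP ord_max j) => [i|] ->; first exact: gz.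
rewrite {1}z_max fmorphV rmorph_prod /=.
rewrite (eq_bigr _ (fun j _ => gz j)) big_split /= invfM -rmorph_prod.
rewrite -z_max; congr (_ * _); rewrite -fmorphV; congr cst.
move: prod_c; rewrite (bigD1_ord ord_max) //= => c1.
have P0 : \prod_(i < r) c (lift ord_max i) != 0.
  by apply/prodf_neq0 => i _; exact: c_neq0.
by apply: (mulIf P0); rewrite mulVf.
Qed.

End Evaluation.
End Torus.

(** * The difference operators as sums over pairs of subsets *)

Section Operators.

Variables (K : fieldType) (vh : K) (r : nat).
Hypothesis vh_neq0 : vh != 0.
Hypothesis vh_nroot : forall k : nat, vh ^+ k = 1 -> k = 0%N.

Local Notation F := (ratfun K r).
Local Notation cst := (@cst K r).
Local Notation z := (@z K r).
Local Notation v := (vh ^+ 2).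
Local Notation q := (v ^- r.+1).
Local Notation shiftI := (@shiftI K vh r).
Local Notation zI := (@zI K r).
Local Notation aI := (@aI K r).
Local Notation Dop := (@Dop K vh r).

Lemma q_neq0 : q != 0.
Proof. by rewrite invr_eq0 !expf_neq0. Qed.

Definition weight (I : {set 'I_r.+1}) (j : 'I_r.+1) : K :=
  v ^+ #|I| * q ^+ (j \in I).

Lemma torus_shift (i : 'I_r.+1) :
  torus (fun j => if j == i then q * v else v) (@shift K vh r i).
Proof.
apply: torus_ev => [j|].
  by case: ifP; rewrite ?mulf_neq0 ?q_neq0 ?expf_neq0.
rewrite (bigD1 i) //= eqxx (eq_bigr (fun=> v)) => [|j /negbTE->] //.
rewrite prodr_const cardC1 card_ord /= -mulrA -exprS mulVf //.
by rewrite !expf_neq0.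
Qed.

Lemma torus_ext (c d : 'I_r.+1 -> K) (g h : F -> F) :
  c =1 d -> g =1 h -> torus c g -> torus d h.
Proof.
move=> cd gh [g' [gE gC gZ]]; exists g'; split=> // [f|j]; first by rewrite gE gh.
by rewrite gZ cd.
Qed.

Lemma torus_shiftI I : torus (weight I) (shiftI I).
Proof.
rewrite /Defs.shiftI -big_filter; set s := [seq i <- _ | _].
have s_uniq : uniq s by rewrite filter_uniq ?index_enum_uniq.
have s_mem j : (j \in s) = (j \in I) by rewrite mem_filter mem_index_enum andbT.
apply: (@torus_ext (fun j => v ^+ size s * q ^+ (j \in s)) _
    (\big[comp/id]_(i <- s) @shift K vh r i)) => // [j|].
  by rewrite /weight -s_mem -(card_uniqP s_uniq) (eq_card s_mem).
elim: {s_mem} s s_uniq => [|i s IH] /=.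
  rewrite big_nil => _; apply: torus_ext (@torus_id K r) => // j.
  by rewrite /= !expr0 mulr1.
case/andP=> i_s /IH s_torus; rewrite big_cons.
apply: torus_ext (torus_comp (torus_shift i) s_torus) => // j.
rewrite inE; case: eqVneq => [->|_] /=; last by rewrite [v ^+ (size s).+1]exprS mulrA.
by rewrite (negbTE i_s) expr0 expr1 [v ^+ (size s).+1]exprS; ring.
Qed.

(** For i != j, apply the i-th shift: it multiplies z i by q * v and z j by v, so a
    proportionality with constant ratio forces q = 1. *)
Lemma z_generic i j k : z i = cst q ^+ k * z j -> i = j /\ k = 0%N.
Proof.
have q_eq1 m : q ^+ m = 1 -> m = 0%N.
  rewrite exprVn -!exprM => /(canRL invrK); rewrite invr1 => /vh_nroot/eqP.
  by rewrite !muln_eq0 /= => /eqP.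
case: (eqVneq i j) => [<-|ij zij]; last first.
  have [g [_ gC gZ]] := torus_shift i.
  have := congr1 g zij; rewrite rmorphM rmorphXn /= gC !gZ eqxx eq_sym.
  rewrite (negbTE ij) [X in _ = X]mulrCA -zij => /(mulIf (z_neq0 _ i))/fmorph_inj.
  rewrite -[RHS]mul1r => /(mulIf (expf_neq0 2 vh_neq0)).
  by rewrite -[q]expr1 => /q_eq1.
rewrite -{1}[z i]mul1r -rmorphXn => /(mulIf (z_neq0 _ i)).
by rewrite -(rmorph1 cst) => /fmorph_inj/esym/q_eq1.
Qed.

Let zr i j : F := z i / (z i - z j).

(** Here C is the intersection of I and J, and S their symmetric difference.  A
    pair from C to the outside of both sets occurs once in a_I and once, with
    z i replaced by q z i, in the shifted a_J. *)
Definition kappa (C S : {set 'I_r.+1}) : F :=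
  \prod_i \prod_j
    if i \in C then
      if j \in C then 1 else
      if j \in S then zr i j
      else zr i j * (cst q * z i / (cst q * z i - z j))
    else if (i \in S) && (j \notin C) && (j \notin S) then zr i j else 1.

Lemma prod2_mkcond (T : finType) (A B : {set T}) (f : T -> T -> F) :
  \prod_(i in A) \prod_(j in B) f i j
  = \prod_i \prod_j if (i \in A) && (j \in B) then f i j else 1.
Proof.
rewrite big_mkcond; apply: eq_bigr => i _; case: (i \in A) => /=.
  by rewrite big_mkcond.
by rewrite big1.
Qed.

Lemma shiftI_aI (I J : {set 'I_r.+1}) : shiftI I (aI J)
  = \prod_(i in J) \prod_(j in ~: J)
      (cst q ^+ (i \in I) * z i
       / (cst q ^+ (i \in I) * z i - cst q ^+ (j \in I) * z j)).
Proof.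
have [g [gE _ gZ]] := torus_shiftI I.
rewrite -gE rmorph_prod; apply: eq_bigr => i _; rewrite rmorph_prod.
apply: eq_bigr => j _; rewrite fmorph_div rmorphB /= !gZ.
have wz s : cst (weight I s) * z s = cst (v ^+ #|I|) * (cst q ^+ (s \in I) * z s).
  by rewrite -rmorphXn mulrA -rmorphM.
rewrite !wz -mulrBr invfM mulrACA mulfV ?mul1r //.
by rewrite fmorph_eq0 !expf_neq0.
Qed.

Lemma shiftI_zI (I J : {set 'I_r.+1}) (p : int) : shiftI I (zI J ^ p)
  = cst ((v ^+ (#|I| * #|J|) * q ^+ #|I :&: J|) ^ p) * zI J ^ p.
Proof.
have [g [gE _ gZ]] := torus_shiftI I.
rewrite -gE fmorphXz fmorphXz -expfzMl; congr (_ ^ _).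
rewrite /Defs.zI rmorph_prod (eq_bigr _ (fun i _ => gZ i)) big_split /=.
congr (_ * _); rewrite -rmorph_prod; congr cst.
rewrite /weight big_split /= prodr_const exprM; congr (_ * _).
rewrite prodrXr; congr (_ ^+ _); rewrite -sum1_card.
rewrite [RHS](eq_bigl (fun i => (i \in J) && (i \in I))) => [|i].
  by rewrite big_mkcondr /=; apply: eq_bigr => i _; case: (i \in I).
by rewrite inE andbC.
Qed.

(** Pair by pair: (i, j) with i in C contributes the same factor whether j is in A
    or in B, because a_I sees j in one case and the shifted a_J in the other (with
    both points shifted alike); the same holds for i in S and j outside.  The only
    factors that remember the splitting are those between A and B. *)
Lemma aI_pair (C A B : {set 'I_r.+1}) :
  [disjoint C & A :|: B] -> [disjoint A & B] ->
  aI (C :|: A) * shiftI (C :|: A) (aI (C :|: B))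
  = kappa C (A :|: B) * setpow z #|B|%:Z A * setpow z #|A|%:Z B
    * pairwS (cst q) z A B.
Proof.
move=> dCS dAB.
have -> : kappa C (A :|: B) * setpow z #|B|%:Z A * setpow z #|A|%:Z B
    * pairwS (cst q) z A B = kappa C (A :|: B) *
     ((\prod_(i in A) \prod_(j in B) zr i j)
      * (\prod_(i in B) \prod_(j in A) (z i / (z i - cst q * z j)))).
  rewrite -!mulrA; congr (_ * _).
  have setpow_card (E D : {set 'I_r.+1}) :
      setpow z #|D|%:Z E = \prod_(i in E) \prod_(j in D) z i.
    by apply: eq_bigr => i _; rewrite prodr_const.
  rewrite !setpow_card [X in _ * (X * _)]exchange_big [X in _ = _ * X]exchange_big.
  rewrite /pairwS -!big_split /=; apply: eq_bigr => i _.
  rewrite -!big_split /=; apply: eq_bigr => j _.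
  by rewrite /zr /pairw invfM; ring.
rewrite shiftI_aI /kappa /Defs.aI !prod2_mkcond -!big_split /=.
apply: eq_bigr => i _; rewrite -!big_split; apply: eq_bigr => j _ /=.
have mem s : ~~ ((s \in C) && ((s \in A) || (s \in B))) /\ ~~ ((s \in A) && (s \in B)).
  split; apply/negP => /andP[].
    by move/(disjointFr dCS); rewrite inE => ->.
  by move/(disjointFr dAB) ->.
rewrite !inE; move: (mem i) (mem j) => [] + + [].
have zrE : z i / (z i - z j) = zr i j by [].
case: (i \in C); case: (i \in A); case: (i \in B) => //= _ _;
case: (j \in C); case: (j \in A); case: (j \in B) => //= _ _;
rewrite ?expr0 ?expr1 ?mul1r ?mulr1 ?zrE //.
by rewrite -mulrBr invfM mulrACA mulfV ?mul1r // fmorph_eq0 q_neq0.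
Qed.

End Operators.

(** The change of indices from (I, J) to the intersection C, the symmetric
    difference S, and the part A of S that lies in I. *)
Lemma sum_pairs_split (T : finType) (V : nmodType) (P Q : pred {set T})
    (Phi : {set T} -> {set T} -> V) :
  \sum_(I : {set T} | P I) \sum_(J : {set T} | Q J) Phi I J
  = \sum_(C : {set T}) \sum_(S : {set T} | [disjoint C & S])
      \sum_(A : {set T} | (A \subset S) && (P (C :|: A) && Q (C :|: (S :\: A))))
        Phi (C :|: A) (C :|: (S :\: A)).
Proof.
rewrite pair_big /= pair_big_dep /= pair_big_dep /=.
pose h (t : {set T} * {set T} * {set T}) :=
  (t.1.1 :|: t.2, t.1.1 :|: (t.1.2 :\: t.2)).
pose h' (p : {set T} * {set T}) :=
  (p.1 :&: p.2, (p.1 :\: p.2) :|: (p.2 :\: p.1), p.1 :\: p.2).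
rewrite (reindex_onto h h') /=; last first.
  move=> [I J] _; rewrite /h /h' /=; congr (_, _); apply/setP=> s;
    by rewrite !inE; case: (s \in I); case: (s \in J).
apply: eq_bigl => -[[C S] A] /=; rewrite [RHS]andbA [RHS]andbC; congr (_ && _).
rewrite /h' /=; apply/eqP/andP => [[CE SE AE]|[dCS AS]].
  split.
    rewrite -setI_eq0 -SE -{1}CE; apply/eqP/setP=> s.
    by rewrite !inE; case: (s \in C); case: (s \in A); case: (s \in S).
  by rewrite -SE -{1}AE subsetUl.
have mem s : ((s \in C) ==> (s \notin S)) && ((s \in A) ==> (s \in S)).
  apply/andP; split; apply/implyP; first by move/(disjointFr dCS) ->.
  exact: (subsetP AS).
congr (_, _, _); apply/setP=> s; have := mem s; rewrite !inE;
  by case: (s \in C); case: (s \in A); case: (s \in S).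
Qed.

Section Operators.

Variables (K : fieldType) (vh : K) (r : nat).
Hypothesis vh_neq0 : vh != 0.

Local Notation F := (ratfun K r).
Local Notation cst := (@cst K r).
Local Notation z := (@z K r).
Local Notation v := (vh ^+ 2).
Local Notation q := (v ^- r.+1).
Local Notation shiftI := (@shiftI K vh r).
Local Notation zI := (@zI K r).
Local Notation aI := (@aI K r).
Local Notation Dop := (@Dop K vh r).

Definition prefactor (a : nat) (n : int) : K :=
  vh ^ (- ((Lam r a a)%:Z * n) - ((\sum_(1 <= b < r.+1) Lam r a b).*2)%N%:Z).

Definition compshift (C S : {set 'I_r.+1}) (f : F) : F :=
  shiftI (C :|: S) (shiftI C f).

(** Both sides scale each z j by a product of powers of v and q that only depends
    on the multiset sum of the two index sets. *)
Lemma shiftI_comp (C S A : {set 'I_r.+1}) f :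
  [disjoint C & S] -> A \subset S ->
  shiftI (C :|: A) (shiftI (C :|: (S :\: A)) f) = compshift C S f.
Proof.
move=> dCS AS; have tor I := torus_shiftI vh_neq0 (r := r) I.
have mem s : ((s \in C) ==> (s \notin S)) && ((s \in A) ==> (s \in S)).
  apply/andP; split; apply/implyP; first by move/(disjointFr dCS) ->.
  exact: (subsetP AS).
apply: (torus_uniq (torus_comp (tor _) (tor _)) (torus_comp (tor _) (tor _))) => s /=.
rewrite /weight mulrACA [RHS]mulrACA -!exprD; congr (_ ^+ _ * _ ^+ _).
  have dCA : [disjoint C & A] by rewrite (disjointWr AS).
  have dCB : [disjoint C & S :\: A] by rewrite (disjointWr (subsetDl _ _)).
  move: (cardsDS AS) (subset_leq_card AS).
  rewrite !cardsU !disjoint_setI0 // !cards0 => ->; lia.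
by have := mem s; rewrite !inE; case: (s \in C); case: (s \in A); case: (s \in S).
Qed.

Lemma zI_setU (A B : {set 'I_r.+1}) : [disjoint A & B] -> zI (A :|: B) = zI A * zI B.
Proof.
move=> dAB; rewrite /Defs.zI -(bigU _ _ _ dAB).
by apply: eq_bigl => s; rewrite !inE.
Qed.

Lemma zI_exp (A : {set 'I_r.+1}) (n : int) : zI A ^ n = setpow z n A.
Proof.
rewrite /setpow /Defs.zI; elim/big_rec2: _ => [|i x y _ <-]; first by rewrite exp1rz.
by rewrite expfzMl.
Qed.

Lemma setpow_add (A : {set 'I_r.+1}) (n m : int) :
  setpow z (n + m) A = setpow z n A * setpow z m A.
Proof.
by rewrite /setpow -big_split; apply: eq_bigr => i _; rewrite expfzDr ?z_neq0.
Qed.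

Lemma pair_term (C S A : {set 'I_r.+1}) (n p : int) f :
  [disjoint C & S] -> A \subset S ->
  let I := C :|: A in let J := C :|: (S :\: A) in
  zI I ^ n * aI I * (shiftI I (zI J ^ p) * shiftI I (aI J) * shiftI I (shiftI J f))
  = cst ((v ^+ (#|I| * #|J|) * q ^+ #|C|) ^ p) * (kappa vh C S * setpow z (n + p) C)
    * splitterm (cst q) z (n + #|S :\: A|%:Z) (p + #|A|%:Z) A (S :\: A)
    * compshift C S f.
Proof.
move=> dCS AS I J; rewrite /I /J shiftI_comp // shiftI_zI //.
have dCA : [disjoint C & A] by rewrite (disjointWr AS).
have dCB : [disjoint C & S :\: A] by rewrite (disjointWr (subsetDl _ _)).
have dAB : [disjoint A & S :\: A].
  by rewrite disjoint_sym disjoints_subset subsetDr.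
have SE : A :|: (S :\: A) = S by rewrite -{1}(setIidPr AS) setID.
have -> : (C :|: A) :&: (C :|: (S :\: A)) = C.
  by rewrite -setUIr disjoint_setI0 // setU0.
have aE := @aI_pair K vh r vh_neq0 C A (S :\: A); rewrite SE in aE.
move: (cst _) => c; rewrite !zI_setU // !expfzMl !zI_exp /splitterm !setpow_add.
have {aE} := aE dCS dAB; move: (shiftI _ (aI _)) (aI _) => u w uw.
transitivity (w * u * (c * setpow z n C * setpow z n A * setpow z p C
  * setpow z p (S :\: A) * compshift C S f)); first by ring.
by rewrite uw; ring.
Qed.

(** The bounds on #|C| guard the truncated subtractions: outside them no pair of
    sets has intersection C. *)
Definition comp_coef (a b : nat) (n p : int) (C S : {set 'I_r.+1}) : F :=
  if (#|C| <= a)%N && (#|C| <= b)%N then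
    cst (prefactor a n * prefactor b p * (v ^+ (a * b) * q ^+ #|C|) ^ p)
    * splitsum (cst q) z (a - #|C|) (n + (b - #|C|)%N%:Z) (p + (a - #|C|)%N%:Z) S
  else 0.

Lemma Dop_comp (a b : nat) (n p : int) (f : F) :
  Dop a n (Dop b p f)
  = \sum_(C : {set 'I_r.+1})
      \sum_(S : {set 'I_r.+1} | [disjoint C & S] && (#|S| + #|C|.*2 == a + b)%N)
        comp_coef a b n p C S * (kappa vh C S * setpow z (n + p) C * compshift C S f).
Proof.
have shiftDop I : shiftI I (Dop b p f) = cst (prefactor b p) *
    \sum_(J : {set 'I_r.+1} | #|J| == b)
      shiftI I (zI J ^ p) * shiftI I (aI J) * shiftI I (shiftI J f).
  have [g [gE gC _]] := torus_shiftI vh_neq0 I.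
  rewrite -gE rmorphM gC rmorph_sum; congr (_ * _); apply: eq_bigr => J _.
  by rewrite !rmorphM /= !gE.
rewrite [LHS]/Defs.Dop -/(prefactor a n).
under eq_bigr => I _ do rewrite shiftDop mulrCA mulr_sumr.
rewrite -mulr_sumr mulrA -rmorphM sum_pairs_split mulr_sumr.
apply: eq_bigr => C _; rewrite mulr_sumr [RHS]big_mkcondr.
apply: eq_bigr => S dCS; rewrite mulr_sumr.
have cA (A : {set 'I_r.+1}) : A \subset S -> #|C :|: A| = (#|C| + #|A|)%N.
  by move=> AS; rewrite cardsU disjoint_setI0 ?(disjointWr AS) // cards0 subn0.
have cB (A : {set 'I_r.+1}) : A \subset S -> #|C :|: (S :\: A)| = (#|C| + (#|S| - #|A|))%N.
  by move=> AS; rewrite cA ?subsetDl // cardsDS.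
rewrite /comp_coef; case: ifPn => [/eqP cS|cS]; last first.
  rewrite big1 // => A /and3P[AS]; rewrite cA // cB // => /eqP ha /eqP hb.
  by have := subset_leq_card AS; move: cS ha hb; lia.
case: ifPn => [/andP[Ca Cb]|Cab]; last first.
  rewrite mul0r big1 // => A /and3P[AS]; rewrite cA // cB // => /eqP ha /eqP hb.
  by have := subset_leq_card AS; move: Cab ha hb; lia.
rewrite /splitsum mulr_sumr mulr_suml; apply: eq_big => [A|A /and3P[AS]].
  apply: andb_id2l => AS; rewrite cA // cB //.
  have := subset_leq_card AS; move: Ca Cb cS.
  move: #|C| #|S| #|A| => x y w xa xb yab wy.
  by apply/andP/eqP => [[/eqP ? /eqP ?]|?]; [lia|split; apply/eqP; lia].
rewrite cA // cB // => /eqP ha /eqP hb.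
rewrite pair_term // cA // cB // ha hb cardsDS //.
have -> : (#|S| - #|A|)%N = (b - #|C|)%N by lia.
have -> : #|A| = (a - #|C|)%N by lia.
by rewrite [X in _ = X * _ * _]rmorphM; ring.
Qed.

End Operators.

(** * The relations between the difference operators *)

Lemma Lam_le r a b : (a <= b)%N -> Lam r a b = (a * (r.+1 - b))%N.
Proof. by move=> ab; rewrite /Lam (minn_idPl ab) (maxn_idPr ab). Qed.

Lemma LamC r a b : Lam r a b = Lam r b a.
Proof. by rewrite /Lam minnC maxnC. Qed.

(** Row sums of the scaled inverse Cartan matrix of type A. *)
Lemma sum_Lam r a : (a <= r.+1)%N ->
  ((\sum_(1 <= b < r.+1) Lam r a b).*2 = a * (r.+1 - a) * r.+1)%N.
Proof.
move=> ar; pose s m := (\sum_(1 <= b < m.+1) Lam r a b)%N.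
have sS m : s m.+1 = (s m + Lam r a m.+1)%N by rewrite /s big_nat_recr.
have s0 : s 0%N = 0%N by rewrite /s big_geq.
(* Partial sums, with separate closed forms up to and beyond the diagonal term. *)
have low m : (m <= a)%N -> ((s m).*2 = (r.+1 - a) * (m * m.+1))%N.
  elim: m => [|m IH] ma; first by rewrite s0 muln0.
  rewrite sS doubleD (IH (ltnW ma)) LamC (Lam_le r ma) -mul2n.
  move: (_ - a)%N => x.
  ring.
have high k : (a + k <= r)%N -> ((s (a + k)%N).*2
    = (r.+1 - a) * (a * a.+1) + a * k * ((r.+1 - a) + (r - (a + k))))%N.
  elim: k => [|k IH] ak; first by rewrite addn0 low // muln0 mul0n addn0.
  rewrite addnS sS doubleD IH; last by lia.
  rewrite Lam_le; last by lia.
  have [d ->] : exists d, r = (a + k.+1 + d)%N by exists (r - (a + k.+1))%N; lia.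
  have -> : ((a + k.+1 + d).+1 - a = (k + d).+2)%N by lia.
  have -> : ((a + k.+1 + d).+1 - (a + k).+1 = d.+1)%N by lia.
  have -> : (a + k.+1 + d - (a + k) = d.+1)%N by lia.
  have -> : (a + k.+1 + d - (a + k).+1 = d)%N by lia.
  rewrite -mul2n; ring.
have [->|ra] := eqVneq a r.+1.
  rewrite subnn muln0 mul0n (eq_big_nat _ _ (F2 := fun=> 0%N)).
    by rewrite big1.
  by move=> b /andP[_ br]; rewrite LamC Lam_le ?subnn ?muln0 // ltnW.
have {}ar : (a <= r)%N by lia.
rewrite -/(s r) -{1}(subnKC ar) high; last by lia.
have [d ->] : exists d, r = (a + d)%N by exists (r - a)%N; lia.
have -> : ((a + d).+1 - a = d.+1)%N by lia.
have -> : (a + d - a = d)%N by lia.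
rewrite subnn.
ring.
Qed.

Section Relations.

Variables (K : fieldType) (vh : K) (r : nat).
Hypothesis vh_neq0 : vh != 0.
Hypothesis vh_nroot : forall k : nat, vh ^+ k = 1 -> k = 0%N.

Local Notation F := (ratfun K r).
Local Notation cst := (@cst K r).
Local Notation z := (@z K r).
Local Notation v := (vh ^+ 2).
Local Notation q := (v ^- r.+1).
Local Notation Dop := (@Dop K vh r).
Local Notation N := (r.+1).

Lemma prefE a n : (a <= N)%N ->
  prefactor vh r a n = vh ^ (- (a%:Z * (N%:Z - a%:Z) * (n + N%:Z))).
Proof.
move=> aN; rewrite /prefactor sum_Lam // Lam_le // !PoszM -subzn //.
by congr (_ ^ _); ring.
Qed.

Lemma vqE x c : v ^+ x * q ^+ c = vh ^ (2 * x%:Z - 2 * N%:Z * c%:Z).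
Proof.
by rewrite exprVn -!exprM !exprnP invr_expz -expfzDr.
Qed.

Lemma vE (m : int) : v ^ m = vh ^ (2 * m).
Proof. by rewrite exprnP exprz_exp. Qed.

Lemma qE (m : int) : q ^ m = vh ^ (- (2 * N%:Z * m)).
Proof.
rewrite -[q]expr1 -[q ^+ 1]mul1r -[1](expr0 v) vqE exprz_exp.
by congr (_ ^ _); ring.
Qed.

Lemma cst_q_neq0 : cst q != 0.
Proof. by rewrite fmorph_eq0 q_neq0. Qed.

Definition vhE := (vqE, vE, qE, exprz_exp).

Lemma Dop_commute_le a b n p f : (a <= b <= N)%N ->
  `|p - n| <= `|b%:Z - a%:Z| + 1 ->
  Dop a n (Dop b p f) = cst (v ^ (- ((Lam r a b)%:Z * (p - n)))) * Dop b p (Dop a n f).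
Proof.
case/andP=> ab bN m_le; have aN := leq_trans ab bN.
rewrite !Dop_comp // mulr_sumr; apply: eq_bigr => C _.
rewrite [(b + a)%N]addnC [p + n]addrC mulr_sumr; apply: eq_bigr => S /andP[_ /eqP cS].
rewrite mulrA; congr (_ * _).
rewrite /comp_coef [X in _ = _ * if X then _ else _]andbC.
case: ifP => [/andP[Ca Cb]|]; last by rewrite mulr0.
rewrite -(@splitsum_comm _ _ _ _ cst_q_neq0 (z_generic vh_neq0 vh_nroot)
   (a - #|C|) (b - #|C|) _ _ (p - n)); try lia; last first.
  move: cS Ca Cb; move: #|C| #|S| => x y xy xa xb; lia.
rewrite !mulrA -fmorphXz -!rmorphM /=; congr (cst _ * _).
rewrite !prefE // Lam_le // !vhE -!expfzDr //; congr (_ ^ _).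
rewrite !PoszM -!subzn //; ring.
Qed.

Lemma Dop_commute a b n p f : (a <= N)%N -> (b <= N)%N ->
  `|p - n| <= `|b%:Z - a%:Z| + 1 ->
  Dop a n (Dop b p f) = cst (v ^ (- ((Lam r a b)%:Z * (p - n)))) * Dop b p (Dop a n f).
Proof.
move=> aN bN m_le; have [ab|/ltnW ba] := leqP a b.
  by rewrite Dop_commute_le ?ab.
have := @Dop_commute_le b a p n f; rewrite ba aN => -> //; last by lia.
rewrite mulrA -rmorphM -expfzDr ?expf_neq0 // LamC.
have -> : - ((Lam r b a)%:Z * (p - n)) + - ((Lam r b a)%:Z * (n - p)) = 0 by ring.
by rewrite expr0z rmorph1 mul1r.
Qed.

Definition qsys_coef (a : nat) (n : int) (C : {set 'I_N}) : K :=
  prefactor vh r a n * prefactor vh r a n * (v ^+ (a * a) * q ^+ #|C|) ^ n.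

Lemma comp_coef_same a n (C S : {set 'I_N}) : (#|C| <= a)%N ->
  comp_coef vh a a n n C S = cst (qsys_coef a n C)
    * splitsum (cst q) z (a - #|C|) (n + (a - #|C|)%N%:Z) (n + (a - #|C|)%N%:Z) S.
Proof. by move=> Ca; rewrite /comp_coef Ca. Qed.

(** If C has a elements, then S is empty and no set of a - 1 elements contains C;
    the right-hand side vanishes as well, since S has no subset of one element. *)
Lemma comp_coef_neighbours a n (C S : {set 'I_N}) :
  (1 <= a <= r)%N -> (#|C| <= a)%N -> (#|S| + #|C|.*2 = a + a)%N ->
  comp_coef vh a.+1 a.-1 n n C S = cst (q ^ (-1) * qsys_coef a n C)
    * splitsum (cst q) z (a - #|C|).+1 (n + (a - #|C|)%N%:Z - 1)
        (n + (a - #|C|)%N%:Z + 1) S.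
Proof.
case: a => // a /andP[_ ar] Ca cS; rewrite /comp_coef /= (leq_trans Ca) //=.
case: ifPn => [Ca'|nCa]; last first.
  rewrite splitsum_gt ?mulr0 //; move: cS Ca nCa; rewrite -ltnNge.
  by move: #|C| #|S| => x y; lia.
rewrite !subSn //.
have -> : n + (a - #|C|).+1%:Z - 1 = n + (a - #|C|)%:Z by lia.
have -> : n + (a - #|C|).+1%:Z + 1 = n + (a - #|C|).+2%:Z by lia.
congr (cst _ * _); rewrite /qsys_coef !prefE; [|lia..].
rewrite !vhE -!expfzDr //; congr (_ ^ _).
by rewrite !PoszM; ring.
Qed.

Lemma comp_coef_step a n (s : int) (C S : {set 'I_N}) :
  (a <= N)%N -> (#|C| <= a)%N ->
  comp_coef vh a a (n + s) (n - s) C S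
  = cst (v ^ (s * (Lam r a a)%:Z) * q ^ (s * (a - #|C|)%N%:Z) * qsys_coef a n C)
    * splitsum (cst q) z (a - #|C|) (n + (a - #|C|)%N%:Z + s)
        (n + (a - #|C|)%N%:Z - s) S.
Proof.
move=> aN Ca; rewrite /comp_coef Ca /= -![n + s + _]addrAC -![n - s + _]addrAC.
congr (cst _ * _); rewrite /qsys_coef !prefE // Lam_le // !vhE -!expfzDr //.
by congr (_ ^ _); rewrite !PoszM -!subzn //; ring.
Qed.

(** The exchange relations are the cases s = 1 and s = -1, one for each order of
    the factors of indices n + 1 and n - 1. *)
Lemma Dop_qsys_termwise (s : int) (c : K) a n f : (1 <= a <= r)%N ->
  (forall a' e (S : {set 'I_N}), #|S| = a'.*2 ->
     cst q ^ (s * a'%:Z) * splitsum (cst q) z a' (e + s) (e - s) S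
     = splitsum (cst q) z a' e e S
       - cst (c * q ^ (-1)) * splitsum (cst q) z a'.+1 (e - 1) (e + 1) S) ->
  cst (v ^ (- (s * (Lam r a a)%:Z))) * Dop a (n + s) (Dop a (n - s) f)
  = Dop a n (Dop a n f) - cst c * Dop a.+1 n (Dop a.-1 n f).
Proof.
move=> ar id_s; rewrite !Dop_comp // addrACA subrr addr0.
have -> : (a.+1 + a.-1 = a + a)%N by lia.
rewrite !mulr_sumr -sumrB; apply: eq_bigr => C _.
rewrite !mulr_sumr -sumrB; apply: eq_bigr => S /andP[_ /eqP cS].
move: (kappa _ _ _ * _ * _) => M; rewrite !mulrA -mulrBl; congr (_ * _).
have [Ca|Ca] := leqP #|C| a; last first.
  have Ca1 : (#|C| <= a.-1)%N = false by apply/negbTE; rewrite -ltnNge; lia.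
  by rewrite /comp_coef Ca1 leqNgt Ca /= andbF !mulr0 subrr.
rewrite comp_coef_step //; last by lia.
rewrite comp_coef_same // comp_coef_neighbours //.
set Q := qsys_coef a n C; set a' := (a - #|C|)%N.
have cS' : #|S| = a'.*2.
  by move: cS Ca; rewrite /a'; move: #|C| #|S| => x y; lia.
transitivity (cst Q * (cst q ^ (s * a'%:Z)
    * splitsum (cst q) z a' (n + a'%:Z + s) (n + a'%:Z - s) S)).
  rewrite !mulrA -fmorphXz -!rmorphM /= !mulrA; congr (cst _ * _).
  rewrite -expfzDr ?expf_neq0 // addNr expr0z mul1r.
  rewrite /Q /qsys_coef; ring.
rewrite id_s // mulrBr !mulrA -!rmorphM /=; congr (_ - cst _ * _).
rewrite /Q /qsys_coef; ring.
Qed.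

Lemma Dop_qsys a n f : (1 <= a <= r)%N ->
  cst (v ^ (- (Lam r a a)%:Z)) * Dop a (n + 1) (Dop a (n - 1) f)
  = Dop a n (Dop a n f) - cst (v ^- N) * Dop a.+1 n (Dop a.-1 n f).
Proof.
move=> ar; rewrite -[(Lam r a a)%:Z]mul1r; apply: Dop_qsys_termwise => // a' e S cS.
rewrite mul1r -exprnP (splitsum_qsys cst_q_neq0 (z_generic vh_neq0 vh_nroot)) //.
by rewrite -[q ^ (-1)]/(q^-1) mulfV ?rmorph1 ?mul1r ?q_neq0.
Qed.

Lemma Dop_qsys_dual a n f : (1 <= a <= r)%N ->
  cst (v ^ (Lam r a a)%:Z) * Dop a (n - 1) (Dop a (n + 1) f)
  = Dop a n (Dop a n f) - Dop a.+1 n (Dop a.-1 n f).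
Proof.
move=> ar; have := @Dop_qsys_termwise (-1) 1 a n f ar.
rewrite mulN1r !opprK rmorph1 !mul1r; apply=> a' e S cS.
rewrite mulN1r -invr_expz -exprnP mulrC.
rewrite (splitsum_qsys_dual cst_q_neq0 (z_generic vh_neq0 vh_nroot)) //.
by rewrite [_ / cst q]mulrC -fmorphV.
Qed.

Lemma Dop_trivial a n f : (a == 0%N) || (a == N) -> Dop a n f = f.
Proof.
move=> a0N; pose I0 : {set 'I_N} := if a == 0%N then set0 else setT.
have aN : (a <= N)%N by case/orP: a0N => /eqP->.
have I0E : (fun I : {set 'I_N} => #|I| == a) =1 pred1 I0.
  move=> I; rewrite /I0 /=; case: eqP a0N => [->|_] /=; first by rewrite cards_eq0.
  move=> /eqP->; rewrite eqEcard subsetT cardsT card_ord eqn_leq.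
  by have := max_card (mem I); rewrite card_ord => ->.
rewrite /Defs.Dop -/(prefactor vh r a n) (big_pred1 I0) //.
have -> : prefactor vh r a n = 1.
  by rewrite prefE //; case/orP: a0N => /eqP->; rewrite ?subrr ?mulr0 ?mul0r oppr0 expr0z.
have -> : zI K I0 = 1.
  rewrite /zI /I0; case: ifP => _; first by rewrite big_set0.
  by rewrite -[RHS](prod_z K r); apply: eq_bigl => i; rewrite inE.
have -> : aI K I0 = 1.
  rewrite /aI /I0; case: ifP => _; rewrite ?big_set0 // big1 // => i _.
  by rewrite setCT big_set0.
rewrite rmorph1 exp1rz !mul1r.
apply: (torus_uniq (torus_shiftI vh_neq0 _) (torus_id K r)) => j.
rewrite /weight /I0; case: eqP a0N => [_|_] /=.
  by rewrite cards0 inE !expr0 mulr1.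
by rewrite inE expr1 cardsT card_ord mulfV // !expf_neq0.
Qed.

End Relations.

(** * Divisibility of symmetric polynomials by the discriminant *)

(** Congruence modulo l is compatible with sums and products, so it only has to be
    checked on constants and variables. *)
Lemma mpoly_rmorph_congr (n : nat) (R : nzRingType) (S : comNzRingType)
    (g h : {rmorphism {mpoly R[n]} -> S}) (l : S) :
  (forall c, g c%:MP = h c%:MP) -> (forall i, exists b, g 'X_i = h 'X_i + l * b) ->
  forall p, exists b, g p = h p + l * b.
Proof.
move=> ghC ghX p.
pose cong u w := exists b : S, u = w + l * b.
have congD u u' w w' : cong u u' -> cong w w' -> cong (u + w) (u' + w').
  by move=> [b ->] [c ->]; exists (b + c); ring.
have congM u u' w w' : cong u u' -> cong w w' -> cong (u * w) (u' * w').
  by move=> [b ->] [c ->]; exists (u' * c + b * w' + l * b * c); ring.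
have cong_refl u : cong u u by exists 0; rewrite mulr0 addr0.
rewrite [p]mpolyE !rmorph_sum; apply: (big_ind2 cong) => [||m _ /=];
  [exact: cong_refl|by move=> *; exact: congD|].
rewrite -mul_mpolyC !rmorphM ghC mpolyXE_id !rmorph_prod; apply: (congM) => //.
apply: (big_ind2 cong) => [||i _]; [exact: cong_refl|by move=> *; exact: congM|].
rewrite !rmorphXn /=.
elim: (m i) => [|k IH]; first by rewrite !expr0.
by rewrite !exprS; apply: (congM) => //; exact: ghX.
Qed.

Section Discriminant.

Variables (K : fieldType) (n : nat).
Local Notation P := {mpoly K[n]}.
Implicit Types (i j k : 'I_n) (p Q : P).

Definition diffX i j : P := 'X_i - 'X_j.

Definition identify i j : {rmorphism P -> P} :=
  mmap (@mpolyC n K) (fun k => 'X_(if k == i then j else k)).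

Lemma identifyX i j k : identify i j 'X_k = 'X_(if k == i then j else k).
Proof. by rewrite /identify /= mmapX mmap1U. Qed.

Lemma msymXU (s : 'S_n) i : msym s 'X_i = 'X_(s i) :> P.
Proof. by rewrite /msym mmapX mmap1U. Qed.

Lemma diffX_neq0 i j : i != j -> diffX i j != 0.
Proof.
move=> ij; rewrite subr_eq0; apply/eqP => /(congr1 (mcoeff U_(i)))/eqP.
by rewrite !mcoeffX eqxx eq_mnm1 [j == i]eq_sym (negbTE ij) oner_eq0.
Qed.

Lemma identify_diffX i j : identify i j (diffX i j) = 0.
Proof. by rewrite rmorphB /= !identifyX eqxx if_same subrr. Qed.

Lemma identify_diffX' i j : identify i j (diffX j i) = 0.
Proof. by rewrite rmorphB /= !identifyX eqxx if_same subrr. Qed.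

(** Identifying the variables i and j is the identity modulo diffX i j. *)
Lemma dvd_diffX i j p : identify i j p = 0 -> exists Q, p = diffX i j * Q.
Proof.
move=> p0.
have [||b] := @mpoly_rmorph_congr _ _ _ (idfun : {rmorphism P -> P})
   (identify i j) (diffX i j) _ _ p.
- by move=> c; rewrite /identify /= mmapC.
- move=> k; rewrite identifyX /=; case: eqP => [->|_].
    by exists 1; rewrite /diffX mulr1 addrC subrK.
  by exists 0; rewrite mulr0 addr0.
by rewrite /= p0 add0r; exists b.
Qed.

Hypothesis two_neq0 : 2%:R != 0 :> K.

(** The quotient by the antisymmetric factor diffX i j is antisymmetric in the
    variables i and j, hence it vanishes when they are identified. *)
Lemma dvd_diffX_twice i j p : i != j -> p \is symmetric -> identify i j p = 0 ->
  exists2 Q, p = diffX i j * Q & identify i j Q = 0.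
Proof.
move=> ij /issymP sym_p /dvd_diffX[Q pE]; exists Q => //.
have QN : msym (tperm i j) Q = - Q.
  have := sym_p (tperm i j); rewrite {1}pE msymM.
  have -> : msym (tperm i j) (diffX i j) = - diffX i j.
    by rewrite /diffX msymB !msymXU tpermL tpermR opprB.
  by rewrite pE mulNr -mulrN => /(mulfI (diffX_neq0 ij)) h; rewrite -[in RHS]h opprK.
have idQ : identify i j (msym (tperm i j) Q) = identify i j Q.
  apply: (@mpoly_rmorph_ext _ _ _ (identify i j \o msym (tperm i j)) (identify i j)).
    by move=> c; rewrite /identify /= /msym !mmapC.
  move=> k; rewrite /= msymXU !identifyX.
  case: tpermP => [->|->|/eqP ki /eqP kj]; rewrite ?eqxx ?if_same //.
have : identify i j Q *+ 2 = 0.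
  by rewrite mulr2n -{1}idQ QN rmorphN addNr.
move/eqP; rewrite -mulr_natl mulf_eq0 -mpolyC_nat mpolyC_eq0 (negbTE two_neq0).
by move/eqP.
Qed.

(** Identifying the variables i and j sends to a nonzero polynomial each factor
    attached to another unordered pair, so the two factors diffX i j of p survive
    in the quotient by the product over the other pairs. *)
Lemma dvd_disc (s : seq ('I_n * 'I_n)) p :
  uniq s -> all (fun u : 'I_n * 'I_n => (u.1 < u.2)%N) s -> p \is symmetric ->
  (forall i j, i != j -> identify i j p = 0) ->
  exists Q, p = (\prod_(u <- s) (diffX u.1 u.2 * diffX u.2 u.1)) * Q.
Proof.
move=> s_uniq s_lt sym_p id0.
elim: s s_uniq s_lt => [|[i j] s IH] /=; first by exists p; rewrite big_nil mul1r.
case/andP=> ij_s s_uniq /andP[lt_ij s_lt].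
have [Q pE] := IH s_uniq s_lt; rewrite big_cons /=.
set M := \prod_(u <- s) _ in pE *.
have ij : i != j by rewrite -val_eqE ltn_eqF.
have dn0 := diffX_neq0 ij.
have [Q1 pE1 Q10] := dvd_diffX_twice ij sym_p (id0 i j ij).
have idM : identify i j M != 0.
  rewrite rmorph_prod prodf_seq_neq0; apply/allP => -[k l] kl_s /=.
  have /= lt_kl := allP s_lt _ kl_s.
  have kl_ij : (k, l) != (i, j) by apply: contraNneq ij_s => <-.
  have neq : (if k == i then j else k) != (if l == i then j else l).
    apply/eqP; case: eqP => ki; case: eqP => li.
    - by move: lt_kl; rewrite ki li ltnn.
    - by move=> jl; move: kl_ij; rewrite ki jl eqxx.
    - by move=> kj; move: lt_kl lt_ij; rewrite kj li; lia.
    - by move=> kl; move: lt_kl; rewrite kl ltnn.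
  rewrite rmorphM !rmorphB /= !identifyX mulf_neq0 // diffX_neq0 //.
  by rewrite eq_sym.
have idQ : identify i j Q = 0.
  by apply: (mulfI idM); rewrite -rmorphM -pE mulr0 id0.
have [Q2 QE] := dvd_diffX idQ.
have Q1E : Q1 = M * Q2.
  by apply: (mulfI dn0); rewrite -pE1 pE QE mulrCA.
have idQ2 : identify i j Q2 = 0.
  by apply: (mulfI idM); rewrite -rmorphM -Q1E mulr0.
have [Q3 Q2E] := dvd_diffX idQ2.
by exists (- Q3); rewrite pE QE Q2E /diffX; ring.
Qed.

Definition disc : P := \prod_i \prod_(j | j != i) diffX i j.

Lemma discE : disc
  = \prod_(u <- [seq u : 'I_n * 'I_n <- index_enum ('I_n * 'I_n)%type | (u.1 < u.2)%N])
      (diffX u.1 u.2 * diffX u.2 u.1).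
Proof.
rewrite /disc pair_big_dep /= (bigID (fun u : 'I_n * 'I_n => (u.1 < u.2)%N)) /=.
rewrite big_filter big_split /=; congr (_ * _).
  apply: eq_bigl => u; rewrite -val_eqE /=; lia.
rewrite (reindex_inj (inv_inj (@swap_pairK _ _))) /=.
apply: eq_bigl => u; rewrite -val_eqE /=; lia.
Qed.

Lemma disc_sym s : msym s disc = disc.
Proof.
rewrite /disc rmorph_prod [RHS](reindex_inj (@perm_inj _ s)) /=.
apply: eq_bigr => i _; rewrite rmorph_prod [RHS](reindex_inj (@perm_inj _ s)) /=.
apply: eq_big => [j|j _]; first by rewrite (inj_eq perm_inj).
by rewrite rmorphB /= !msymXU.
Qed.

Lemma disc_neq0 : disc != 0.
Proof.
by apply/prodf_neq0 => i _; apply/prodf_neq0 => j ji; rewrite diffX_neq0 // eq_sym.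
Qed.

Lemma sym_disc_quotient p : p \is symmetric ->
  (forall i j, i != j -> identify i j p = 0) ->
  exists2 Q, Q \is symmetric & p = disc * Q.
Proof.
move=> sym_p id0.
have [||Q pE] := @dvd_disc
  [seq u : 'I_n * 'I_n <- index_enum ('I_n * 'I_n)%type | (u.1 < u.2)%N] p _ _ sym_p id0.
- by rewrite filter_uniq ?index_enum_uniq.
- exact: filter_all.
rewrite -discE in pE; exists Q => //; apply/issymP => s.
apply: (mulfI disc_neq0); rewrite -{1}(disc_sym s) -msymM -pE.
exact: (issymP _ sym_p).
Qed.

End Discriminant.

(** * The difference operators preserve symmetric polynomials *)

Section SymmetricStability.

Variables (K : fieldType) (vh : K) (r : nat).
Hypothesis vh_neq0 : vh != 0.
Hypothesis vh_nroot : forall k : nat, vh ^+ k = 1 -> k = 0%N.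
Hypothesis two_neq0 : 2%:R != 0 :> K.

Local Notation N := (r.+1).
Local Notation F := (ratfun K r).
Local Notation P := {mpoly K[N]}.
Local Notation cst := (@cst K r).
Local Notation z := (@z K r).
Local Notation shiftI := (@shiftI K vh r).
Local Notation zI := (@zI K r).
Local Notation aI := (@aI K r).
Local Notation Dop := (@Dop K vh r).
Implicit Types (I : {set 'I_N}) (s : 'S_N).

Definition atz : {rmorphism P -> F} := mmap cst z.

Lemma atzX i : atz 'X_i = z i.
Proof. by rewrite /atz /= mmapX mmap1U. Qed.

Lemma atzC c : atz c%:MP = cst c.
Proof. by rewrite /atz /= mmapC. Qed.

(** As the product of all the z i is 1, a negative power of z_I is a positive power
    of the product over the complement of I. *)
Definition zIpoly (n : int) I : P :=
  match n with
  | Posz k => (\prod_i if i \in I then 'X_i else 1) ^+ k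
  | Negz k => (\prod_i if i \in I then 1 else 'X_i) ^+ k.+1
  end.

Lemma atz_zIpoly n I : atz (zIpoly n I) = zI I ^ n.
Proof.
case: n => k; rewrite rmorphXn rmorph_prod /=.
  rewrite -exprnP /Defs.zI [in RHS]big_mkcond; congr (_ ^+ _).
  by apply: eq_bigr => i _; case: ifP => _; rewrite ?rmorph1 ?atzX.
rewrite NegzE -exprnN -exprVn; congr (_ ^+ _).
have zI0 : zI I != 0 by apply/prodf_neq0 => i _; exact: z_neq0.
apply: (mulfI zI0); rewrite mulfV //; apply: etrans (prod_z K r).
rewrite /Defs.zI [X in X * _]big_mkcond.
rewrite -big_split; apply: eq_bigr => i _ /=.
by case: ifP => _; rewrite ?rmorph1 ?atzX ?mulr1 ?mul1r.
Qed.

(** The product of a_I with disc, in which the denominators of a_I cancel. *)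
Definition aIpoly I : P :=
  \prod_i \prod_(j | j != i)
    if (i \in I) && (j \notin I) then 'X_i else diffX K i j.

Lemma subz_neq0 i j : i != j -> z i - z j != 0.
Proof.
move=> ij; rewrite subr_eq0; apply: contra_neq ij => zij.
by case: (@z_generic K vh r vh_neq0 vh_nroot i j 0) => //; rewrite mul1r.
Qed.

Lemma atz_aIpoly I : atz (aIpoly I) = atz (disc K N) * aI I.
Proof.
rewrite !rmorph_prod /Defs.aI [X in _ * X]big_mkcond -big_split.
apply: eq_bigr => i _ /=; rewrite !rmorph_prod.
have -> : (if i \in I then \prod_(j in ~: I) (z i / (z i - z j)) else 1)
    = \prod_(j | j != i) if (i \in I) && (j \notin I) then z i / (z i - z j) else 1.
  case: (boolP (i \in I)) => [iI|_] /=; last by rewrite big1.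
  rewrite -big_mkcondr; apply: eq_bigl => j; rewrite inE andb_idl //.
  by apply: contraNneq => ->.
rewrite -big_split; apply: eq_bigr => j ji /=.
case: ifP => _; rewrite ?mulr1 // rmorphB /= !atzX mulrC divfK //.
by rewrite subz_neq0 // eq_sym.
Qed.

Definition shiftpoly I : {rmorphism P -> P} :=
  mmap (@mpolyC N K) (fun j => (weight vh I j)%:MP * 'X_j).

Lemma shiftpolyX I j : shiftpoly I 'X_j = (weight vh I j)%:MP * 'X_j.
Proof. by rewrite /shiftpoly /= mmapX mmap1U. Qed.

Lemma atz_shiftpoly I p : atz (shiftpoly I p) = shiftI I (atz p).
Proof.
have [g [gE gC gZ]] := torus_shiftI vh_neq0 I; rewrite -gE.
apply: (@mpoly_rmorph_ext _ _ _ (atz \o shiftpoly I) (g \o atz)) => [c|j] /=.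
  by rewrite /shiftpoly /= mmapC !atzC gC.
by rewrite shiftpolyX rmorphM /= atzC !atzX gZ.
Qed.

Section Action.

Variable s : 'S_N.
Let sI I := s @: I.

Lemma mem_sI I i : (s i \in sI I) = (i \in I).
Proof. by rewrite mem_imset //; exact: perm_inj. Qed.

Lemma msym_zIpoly n I : msym s (zIpoly n I) = zIpoly n (sI I).
Proof.
case: n => k; rewrite rmorphXn rmorph_prod /=; congr (_ ^+ _);
  rewrite [RHS](reindex_inj (@perm_inj _ s)); apply: eq_bigr => i _ /=;
  by rewrite mem_sI; case: ifP => _; rewrite ?msymXU ?msym1.
Qed.

Lemma msym_aIpoly I : msym s (aIpoly I) = aIpoly (sI I).
Proof.
rewrite rmorph_prod [RHS](reindex_inj (@perm_inj _ s)); apply: eq_bigr => i _.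
rewrite rmorph_prod [RHS](reindex_inj (@perm_inj _ s)) /=.
apply: eq_big => [j|j _]; first by rewrite (inj_eq perm_inj).
by rewrite !mem_sI; case: ifP => _; rewrite ?msymB !msymXU.
Qed.

Lemma msym_shiftpoly I p : p \is symmetric ->
  msym s (shiftpoly I p) = shiftpoly (sI I) p.
Proof.
move=> /issymP sym_p; rewrite -{2}(sym_p s).
apply: (@mpoly_rmorph_ext _ _ _ (msym s \o shiftpoly I) (shiftpoly (sI I) \o msym s)).
  by move=> c; rewrite /= /shiftpoly /= mmapC /msym !mmapC.
move=> j; rewrite /= msymXU !shiftpolyX msymM msymXU {1}/msym mmapC.
by rewrite /weight mem_sI card_imset //; exact: perm_inj.
Qed.

End Action.

Definition numerator (a : nat) (n : int) (p : P) : P :=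
  \sum_(I : {set 'I_N} | #|I| == a) zIpoly n I * aIpoly I * shiftpoly I p.

Lemma numerator_sym a n p : p \is symmetric -> numerator a n p \is symmetric.
Proof.
move=> sym_p; apply/issymP => s; rewrite rmorph_sum.
rewrite [RHS](reindex_inj (imset_inj (@perm_inj _ s))) /=.
apply: eq_big => [I|I _]; first by rewrite card_imset //; exact: perm_inj.
by rewrite !msymM msym_zIpoly msym_aIpoly msym_shiftpoly.
Qed.

(** At most one of the two factors attached to the unordered pair of i and j is
    cancelled by a_I; the other one vanishes. *)
Lemma identify_aIpoly i j I : i != j -> identify K i j (aIpoly I) = 0.
Proof.
move=> ij; rewrite rmorph_prod; have [iI|iI] := boolP ((i \in I) && (j \notin I)).
  case/andP: iI => iI jI; rewrite (bigD1 j) //= rmorph_prod (bigD1 i) //=.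
  by rewrite (negbTE jI) /= identify_diffX' !mul0r.
rewrite (bigD1 i) //= rmorph_prod (bigD1 j) 1?eq_sym //=.
by rewrite (negbTE iI) identify_diffX !mul0r.
Qed.

(** With f the value of p at z, numerator a n p / disc evaluates to the sum over I
    that defines D_(a,n) f. *)
Lemma sympoly_Dop a n f : sympoly f -> sympoly (Dop a n f).
Proof.
case=> p sym_p ->.
have [||Q sym_Q QE] := @sym_disc_quotient K N two_neq0 (numerator a n p).
- exact: numerator_sym.
- move=> i j ij; rewrite rmorph_sum big1 // => I _ /=.
  by rewrite !rmorphM identify_aIpoly // mulr0 mul0r.
have disc0 : atz (disc K N) != 0.
  rewrite rmorph_prod; apply/prodf_neq0 => i _; rewrite rmorph_prod.
  by apply/prodf_neq0 => j ji; rewrite rmorphB /= !atzX subz_neq0 // eq_sym.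
rewrite /Defs.Dop -/(prefactor vh r a n) -[mmap _ _ p]/(atz p).
exists ((prefactor vh r a n)%:MP * Q).
  by rewrite mul_mpolyC rpredZ.
rewrite -[mmap _ _ _]/(atz _) rmorphM atzC; congr (_ * _).
apply: (mulfI disc0); rewrite -rmorphM -QE rmorph_sum mulr_sumr.
apply: eq_bigr => I _; rewrite !rmorphM /= atz_zIpoly atz_aIpoly atz_shiftpoly.
by ring.
Qed.

End SymmetricStability.

(** * The representation of the dual quantum Q-system algebra *)

Lemma vh_neq0 : vh != 0.
Proof. by rewrite tofrac_eq0 polyX_eq0. Qed.

Lemma vh_nroot k : vh ^+ k = 1 -> k = 0%N.
Proof.
rewrite /vh -rmorphXn -(rmorph1 (@tofrac _)) => /eqP; rewrite tofrac_eq => /eqP.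
by move/(congr1 (fun p : {poly rat} => size p)); rewrite size_polyXn size_poly1 => -[].
Qed.

Lemma two_neq0 : 2%:R != 0 :> Kv.
Proof. by rewrite -(rmorph_nat (@tofrac _)) tofrac_eq0 -polyC_natr polyC_eq0. Qed.

Section Representation.

Import monalg.

Variable r : nat.
Local Notation F := (ratfun Kv r).
Local Notation cst := (@cst Kv r).
Local Notation freeA := (freeA r).
Local Notation monom := {fmonom ('I_r.+2 * int)%type}.

Lemma Dop_sum (J : Type) (s : seq J) (g : J -> F) a n :
  Dop vh a n (\sum_(j <- s) g j) = \sum_(j <- s) Dop vh a n (g j).
Proof.
rewrite /Dop -mulr_sumr exchange_big /=; congr (_ * _); apply: eq_bigr => I _.
have [h [hE _ _]] := torus_shiftI vh_neq0 I.
by rewrite -hE rmorph_sum mulr_sumr; apply: eq_bigr => j _; rewrite hE.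
Qed.

Lemma Dop_cst c a n f : Dop vh a n (cst c * f) = cst c * Dop vh a n f.
Proof.
rewrite /Dop mulrCA; congr (_ * _); rewrite mulr_sumr; apply: eq_bigr => I _.
have [h [hE hC _]] := torus_shiftI vh_neq0 I.
by rewrite -!hE rmorphM hC mulrCA.
Qed.

(** The monomials of the free algebra are words in the generators. *)
Definition act (m : monom) (f : F) : F :=
  foldr (fun (u : 'I_r.+2 * int) g => Dop vh u.1 u.2 g) f m.

Lemma act_mul m1 m2 f : act (mmul m1 m2) f = act m1 (act m2 f).
Proof. by rewrite /act fmM foldr_cat. Qed.

Lemma act_sum (J : Type) (s : seq J) (g : J -> F) m :
  act m (\sum_(j <- s) g j) = \sum_(j <- s) act m (g j).
Proof. by rewrite /act; elim: (m : seq _) => //= u w ->; rewrite Dop_sum. Qed.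

Lemma act_cst c m f : act m (cst c * f) = cst c * act m f.
Proof. by rewrite /act; elim: (m : seq _) => //= u w ->; rewrite Dop_cst. Qed.

Lemma sympoly_act m f : sympoly f -> sympoly (act m f).
Proof.
rewrite /act => sym_f; elim: (m : seq _) => //= u w IH.
exact: (sympoly_Dop vh_neq0 vh_nroot two_neq0).
Qed.

Definition cstZ : {rmorphism Zv -> F} := cst \o val.

Definition freerep (x : freeA) (f : F) : F := mmap cstZ (act^~ f) x.

Lemma freerepB x y f : freerep (x - y) f = freerep x f - freerep y f.
Proof. exact: mmapB. Qed.

Lemma freerep0 f : freerep 0 f = 0.
Proof. exact: mmap0. Qed.

Lemma freerep_sum (J : Type) (s : seq J) (g : J -> F) x :
  freerep x (\sum_(j <- s) g j) = \sum_(j <- s) freerep x (g j).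
Proof.
rewrite /freerep [RHS]exchange_big; apply: eq_bigr => m _ /=.
by rewrite act_sum mulr_sumr.
Qed.

Lemma freerep_cst c x f : freerep x (cst c * f) = cst c * freerep x f.
Proof.
by rewrite /freerep /mmap mulr_sumr; apply: eq_bigr => m _; rewrite act_cst mulrCA.
Qed.

Lemma freerepM x y f : freerep (x * y) f = freerep x (freerep y f).
Proof.
have freerep_suml (J : Type) (s : seq J) (g : J -> freeA) :
    freerep (\sum_(j <- s) g j) f = \sum_(j <- s) freerep (g j) f.
  exact: (raddf_sum (mmap cstZ (act^~ f) : {additive freeA -> F})).
rewrite [x * y]malgME freerep_suml; apply: eq_bigr => m1 _ /=.
rewrite freerep_suml act_sum mulr_sumr; apply: eq_bigr => m2 _ /=.
by rewrite /freerep mmapU [X in X * _](rmorphM cstZ) act_mul act_cst mulrA.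
Qed.

Lemma freerepC c f : freerep c%:MP f = cst (c : Kv) * f.
Proof. by rewrite /freerep mmapU /act fm1. Qed.

Lemma freerepZ c x f : freerep (c *: x) f = cst (c : Kv) * freerep x f.
Proof. by rewrite -mul_malgC freerepM freerepC. Qed.

Lemma freerep_gen a k f : (a <= r.+1)%N -> freerep (freeQ r a k) f = Dop vh a k f.
Proof.
move=> ar; rewrite /freerep mmapU [X in X * _](rmorph1 cstZ) mul1r /act fmU /=.
by rewrite inordK.
Qed.

Lemma freerep1 f : freerep 1 f = f.
Proof. by rewrite -mpolyC1E freerepC rmorph1 mul1r. Qed.

Lemma freerep_commutator c x y f :
  freerep (x * y - c *: (y * x)) f
  = freerep x (freerep y f) - cst (c : Kv) * freerep y (freerep x f).
Proof. by rewrite freerepB freerepZ; congr (_ - _ * _); exact: freerepM. Qed.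

Lemma freerep_exchange c x y w s t f :
  freerep (c *: (x * w) - (y ^+ 2 - s * t)) f
  = cst (c : Kv) * freerep x (freerep w f)
    - (freerep y (freerep y f) - freerep s (freerep t f)).
Proof.
by rewrite freerepB freerepZ freerepB; congr (_ * _ - (_ - _)); exact: freerepM.
Qed.

(** The factors of the exchange relator come in the order n - 1, n + 1, so it is
    Dop_qsys_dual, not Dop_qsys, that makes it act by 0. *)
Lemma freerep_ideal x : in_ideal (@relatorA r) x -> forall f, freerep x f = 0.
Proof.
elim=> {x} [u rel_u||x y _ IHx _ IHy|b x _ IH|b x _ IH] f.
- have gen a k : (a <= r.+1)%N -> forall g, freerep (freeQ r a k) g = Dop vh a k g.
    by move=> ar g; exact: freerep_gen.
  case: rel_u => {u} [k|k|a b n p|a n].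
  + move: (freeQ r 0 k) (gen _ k (leq0n r.+1)) => x xE.
    by rewrite freerepB freerep1 xE (Dop_trivial vh_neq0) // subrr.
  + move: (freeQ r r.+1 k) (gen _ k (leqnn r.+1)) => x xE.
    by rewrite freerepB freerep1 xE (Dop_trivial vh_neq0) ?eqxx ?orbT // subrr.
  + move=> /andP[_ /leqW ar] /andP[_ /leqW br] np.
    move: (freeQ r a n) (freeQ r b p) (gen _ n ar) (gen _ p br) => x y xE yE.
    rewrite freerep_commutator !(xE, yE).
    by rewrite (Dop_commute vh_neq0 vh_nroot) // subrr.
  + move=> ar; have /andP[a_gt0 ar1] := ar; have aN := leqW ar1.
    move: (freeQ r a (n - 1)) (freeQ r a n) (freeQ r a (n + 1))
      (gen _ (n - 1) aN) (gen _ n aN) (gen _ (n + 1) aN) => x y w xE yE wE.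
    move: (freeQ r a.+1 n) (freeQ r a.-1 n)
      (gen a.+1 n ar1) (gen _ n (leq_trans (leq_pred a) aN)) => s t sE tE.
    rewrite freerep_exchange !(xE, yE, wE, sE, tE).
    by rewrite (Dop_qsys_dual vh_neq0 vh_nroot) // subrr.
- exact: freerep0.
- by rewrite freerepB IHx IHy subrr.
- by rewrite freerepM IH -[0](mul0r 0) -(rmorph0 cst) freerep_cst rmorph0 !mul0r.
- by rewrite freerepM IH.
Qed.

Definition rep (x : algA r) (f : F) : F := freerep (repr x) f.

Lemma rep_pclass x f : rep (pclass (@relatorA r) x) f = freerep x f.
Proof.
apply/eqP; rewrite -subr_eq0 -freerepB; apply/eqP/freerep_ideal/asboolP.
apply/pclassP; exact: pclassK.
Qed.

Lemma rep_representation : representation rep.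
Proof.
split=> [x f g|x c f|x y f|c x f|f|x y f].
- have := freerep_sum [:: f; g] id (repr x).
  by rewrite !big_cons !big_nil !addr0.
- exact: freerep_cst.
- rewrite -[x]pclassK -[y]pclassK -pclassD !rep_pclass.
  exact: mmapD.
- by rewrite -[x]pclassK -pclass_scale !rep_pclass freerepZ.
- by rewrite rep_pclass freerep1.
- by rewrite -[x]pclassK -[y]pclassK -pclass_mul !rep_pclass freerepM.
Qed.

Lemma sympoly0 : sympoly (0 : F).
Proof. by exists 0; rewrite ?rpred0 // rmorph0. Qed.

Lemma sympolyD (f g : F) : sympoly f -> sympoly g -> sympoly (f + g).
Proof.
by move=> [p sp ->] [p' sp' ->]; exists (p + p'); rewrite ?rpredD // rmorphD.
Qed.

Lemma sympolyZ c (f : F) : sympoly f -> sympoly (cst c * f).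
Proof.
move=> [p sp ->]; exists (c *: p); first by rewrite rpredZ.
by rewrite -mul_mpolyC rmorphM /= mpoly.mmapC.
Qed.

Lemma sympoly_rep x f : sympoly f -> sympoly (rep x f).
Proof.
move=> sym_f; rewrite /rep /freerep /mmap.
elim/big_ind: _ => [|g h|m _]; [exact: sympoly0|exact: sympolyD|].
exact/sympolyZ/sympoly_act.
Qed.

End Representation.

Theorem theorem5p3 (r : nat) (hr : (1 <= r)%N) :
  (exists rho : algA r -> ratfun Kv r -> ratfun Kv r,
     [/\ representation rho,
         forall (a : nat) (n : int) (f : ratfun Kv r),
           (a <= r.+1)%N -> rho (genQ r a n) f = Dop vh a n f
       & forall (x : algA r) (f : ratfun Kv r), sympoly f -> sympoly (rho x f)])
  /\ (forall (a b : nat) (n p : int) (f : ratfun Kv r),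
        (1 <= a <= r)%N -> (1 <= b <= r)%N ->
        `|p - n| <= `|b%:Z - a%:Z| + 1 ->
        Dop vh a n (Dop vh b p f)
        = cst r (v ^ (- ((Lam r a b)%:Z * (p - n))))
          * Dop vh b p (Dop vh a n f))
  /\ (forall (a : nat) (n : int) (f : ratfun Kv r),
        (1 <= a <= r)%N ->
        cst r (v ^ (- (Lam r a a)%:Z))
          * Dop vh a (n + 1) (Dop vh a (n - 1) f)
        = Dop vh a n (Dop vh a n f)
          - cst r (v ^- r.+1) * Dop vh a.+1 n (Dop vh a.-1 n f)).
Proof.
split; last split.
- exists (@rep r); split; first exact: rep_representation.
    by move=> a n f ar; rewrite rep_pclass freerep_gen.
  exact: sympoly_rep.
- move=> a b n p f /andP[_ /leqW ar] /andP[_ /leqW br].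
  exact: (Dop_commute vh_neq0 vh_nroot).
- move=> a n f; exact: (Dop_qsys vh_neq0 vh_nroot).
Qed.
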